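(* Let $f\in\mathrm{Hol}(\Pi,\mathbb{C})$ be the generator of a one-parameter continuous semigroup $\mathbf{F}=\{F_t\}_{t\ge 0}\subset\mathrm{Hol}(\Pi)$ with the Denjoy--Wolff point at $\infty$, and let $h$ be its associated Koenigs function. For all $\theta_1,\theta_2>0$ such that $\theta_1+\theta_2\le\pi$, the following are equivalent: (i) $\mathbf{F}$ can be analytically extended to a semigroup $\{F_\zeta\}_{\zeta\in\Omega(\theta_1,\theta_2)}$ such that for each $z\in\Pi$, the function $F_\zeta(z)$ tends to $\infty$ along every ray in $\Omega(\theta_1,\theta_2)$; (ii) the function $f$ satisfies $$-\frac{\pi}{2}+\theta_1\le \arg f(z)\le \frac{\pi}{2}-\theta_2,\qquad z\in\Pi;$$ (iii) $h\in\Sigma(\Pi,\theta_1,\theta_2)$.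
   Context: $\Pi=\{z\in\mathbb{C}:\mathrm{Re}\,z>0\}$. $\mathrm{Hol}(D,U)$ is the set of holomorphic functions on $D$ with values in $U$, and $\mathrm{Hol}(D):=\mathrm{Hol}(D,D)$. A one-parameter continuous semigroup on $\Pi$ is a family $\{F_t\}_{t\ge0}\subset\mathrm{Hol}(\Pi)$ with $F_t(F_s(z))=F_{t+s}(z)$ for all $t,s\ge0$, $z\in\Pi$, and $\lim_{t\to0^+}F_t(z)=z$ for all $z\in\Pi$. Its (infinitesimal) generator is the holomorphic function $f(z)=\lim_{t\to0^+}\frac{F_t(z)-z}{t}$, which always exists. A semigroup that contains neither the identity nor an elliptic automorphism (for $t>0$) has a unique Denjoy--Wolff point $\tau\in\overline{\Pi}\cup\{\infty\}$, i.e. a point to which $F_t(z)$ converges as $t\to\infty$ for all $z\in\Pi$. The associated Koenigs function of a semigroup without interior fixed points is the unique univalent solution $h\in\mathrm{Hol}(\Pi,\mathbb{C})$ of $h(F_t(z))=h(z)+t$ ($z\in\Pi$, $t\ge0$) normalized by $h(1)=0$. $\Omega(\theta_1,\theta_2)=\{\zeta:-\theta_1<\arg\zeta<\theta_2\}$. An analytic extension of $\mathbf{F}$ to $\Omega(\theta_1,\theta_2)$ is a family $\{F_\zeta\}_{\zeta\in\Omega(\theta_1,\theta_2)}\subset\mathrm{Hol}(\Pi)$, coinciding with $F_t$ for $\zeta=t>0$, analytic in $\zeta$ for each $z\in\Pi$, and satisfying $F_{\zeta_1}\circ F_{\zeta_2}=F_{\zeta_1+\zeta_2}$. A ray in $\Omega(\theta_1,\theta_2)$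 is a set $\{te^{i\theta}:t>0\}$ with $\theta\in(-\theta_1,\theta_2)$. For $\theta\in\mathbb{R}$, $\Sigma(\Pi,\theta)$ is the class of univalent $h\in\mathrm{Hol}(\Pi,\mathbb{C})$ with $h(1)=0$ such that for each $z\in\Pi$: $h(z)+te^{i\theta}\in h(\Pi)$ for each $t>0$, and $\lim_{t\to\infty}h^{-1}(h(z)+te^{i\theta})=\infty$. Finally, $\Sigma(\Pi,\theta_1,\theta_2)=\bigcap_{\theta\in(-\theta_1,\theta_2)}\Sigma(\Pi,\theta)$. *)

(* Defs.v *)
From Stdlib Require Import Reals Lra ClassicalEpsilon.
From Coquelicot Require Import Coquelicot.

Open Scope R_scope.

Definition Pi (z : C) : Prop := 0 < Re z.

Definition cis (theta : R) : C := (cos theta, sin theta).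

(* Principal argument, with values in (-PI, PI] for z <> 0; arg 0 is a junk
   value, so uses of [arg] are guarded by z <> 0. See [arg_spec]. *)
Definition arg (z : C) : R :=
  if Rle_dec 0 (Im z) then acos (Re z / Cmod z) else - acos (Re z / Cmod z).

Lemma arg_spec (z : C) : z <> 0%C ->
  - PI < arg z <= PI /\ z = (Cmod z * cis (arg z))%C.
Proof.
intros Hz.
assert (Hm : 0 < Cmod z) by (apply Cmod_gt_0; exact Hz).
assert (H2 : Cmod z ^ 2 = Re z ^ 2 + Im z ^ 2) by apply Cmod2_alt.
set (m := Cmod z) in *.
assert (Hq : (Re z / m)² = 1 - (Im z / m)²).
{ unfold Rsqr. field_simplify; try lra.
  replace (Re z ^ 2) with (m ^ 2 - Im z ^ 2) by lra. field. lra. }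
assert (Hb : -1 <= Re z / m <= 1).
{ assert (0 <= (Im z / m)²) by apply Rle_0_sqr.
  unfold Rsqr in *. split; nra. }
assert (Hc : cos (acos (Re z / m)) = Re z / m) by (apply cos_acos; exact Hb).
assert (Hs : sin (acos (Re z / m)) = Rabs (Im z) / m).
{ rewrite sin_acos by exact Hb. rewrite Hq.
  replace (1 - (1 - (Im z / m)²)) with ((Im z / m)²) by ring.
  rewrite sqrt_Rsqr_abs. unfold Rdiv. rewrite Rabs_mult.
  rewrite (Rabs_pos_eq (/ m)); [reflexivity |].
  left. apply Rinv_0_lt_compat; exact Hm. }
assert (Hr := acos_bound (Re z / m)).
assert (Hpi := PI_RGT_0).
unfold arg; fold m.
destruct (Rle_dec 0 (Im z)) as [Hi | Hi].
- rewrite (Rabs_pos_eq _ Hi) in Hs. split; [lra |].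
  unfold cis. rewrite Hc, Hs. destruct z as [x y].
  unfold Cmult, RtoC; simpl; simpl in *. f_equal; field; lra.
- rewrite Rabs_left in Hs by lra. split.
  + split; [| lra].
    destruct (Req_dec (acos (Re z / m)) PI) as [He | He]; [| lra].
    exfalso. rewrite He, sin_PI in Hs.
    assert (0 < - Im z / m) by (apply Rdiv_lt_0_compat; lra). lra.
  + unfold cis. rewrite cos_neg, sin_neg, Hc, Hs. destruct z as [x y].
    unfold Cmult, RtoC; simpl; simpl in *. f_equal; field; lra.
Qed.

(* Maps between subsets of C are total functions C -> C of which only the
   values on the domain are ever constrained. The domains D used below are
   open, so complex differentiability at each point of D is holomorphy. *)
Definition holomorphic_on (D : C -> Prop) (f : C -> C) : Prop :=
  forall z, D z -> ex_derive f z.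

Definition Hol (D U : C -> Prop) (f : C -> C) : Prop :=
  holomorphic_on D f /\ forall z, D z -> U (f z).

Definition whole (z : C) : Prop := True.

Definition injective_on (D : C -> Prop) (f : C -> C) : Prop :=
  forall z w, D z -> D w -> f z = f w -> z = w.

Definition univalent_on (D : C -> Prop) (f : C -> C) : Prop :=
  holomorphic_on D f /\ injective_on D f.

Definition image (D : C -> Prop) (f : C -> C) (w : C) : Prop :=
  exists z, D z /\ f z = w.

Definition inv_on (D : C -> Prop) (f : C -> C) (w : C) : C :=
  epsilon (inhabits (RtoC 0)) (fun z => D z /\ f z = w).

Lemma inv_on_image (D : C -> Prop) (f : C -> C) (w : C) :
  image D f w -> D (inv_on D f w) /\ f (inv_on D f w) = w.
Proof. intros H. exact (epsilon_spec _ _ H). Qed.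

Lemma inv_on_left (D : C -> Prop) (f : C -> C) (z : C) :
  injective_on D f -> D z -> inv_on D f (f z) = z.
Proof.
intros Hf Hz.
destruct (inv_on_image D f (f z)) as [H1 H2]; [exists z; auto |].
apply Hf; assumption.
Qed.

(* g(t) tends to the point at infinity of the Riemann sphere as t -> +oo. *)
Definition tends_to_infinity (g : R -> C) : Prop :=
  filterlim (fun t => Cmod (g t)) (Rbar_locally p_infty) (Rbar_locally p_infty).

Definition continuous_semigroup (F : R -> C -> C) : Prop :=
  (forall t, 0 <= t -> Hol Pi Pi (F t)) /\
  (forall t s z, 0 <= t -> 0 <= s -> Pi z -> F t (F s z) = F (t + s) z) /\
  (forall z, Pi z -> filterlim (fun t => F t z) (at_right 0) (locally z)).

Definition is_generator (F : R -> C -> C) (f : C -> C) : Prop :=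
  Hol Pi whole f /\
  forall z, Pi z ->
    filterlim (fun t : R => ((F t z - z) / t)%C) (at_right 0) (locally (f z)).

Definition is_identity (g : C -> C) : Prop := forall z, Pi z -> g z = z.

Definition automorphism (g : C -> C) : Prop :=
  Hol Pi Pi g /\ injective_on Pi g /\ forall w, Pi w -> image Pi g w.

Definition elliptic_automorphism (g : C -> C) : Prop :=
  automorphism g /\ ~ is_identity g /\ exists z, Pi z /\ g z = z.

Definition denjoy_wolff_at_infinity (F : R -> C -> C) : Prop :=
  (forall t, 0 < t -> ~ is_identity (F t) /\ ~ elliptic_automorphism (F t)) /\
  (forall z, Pi z -> tends_to_infinity (fun t => F t z)).

Definition is_koenigs (F : R -> C -> C) (h : C -> C) : Prop :=
  univalent_on Pi h /\
  (forall t z, 0 <= t -> Pi z -> h (F t z) = (h z + t)%C) /\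
  h 1%C = 0%C.

Definition Omega (theta1 theta2 : R) (zeta : C) : Prop :=
  zeta <> 0%C /\ - theta1 < arg zeta < theta2.

Definition analytic_extension (F : R -> C -> C) (theta1 theta2 : R)
    (G : C -> C -> C) : Prop :=
  (forall zeta, Omega theta1 theta2 zeta -> Hol Pi Pi (G zeta)) /\
  (forall (t : R) z, 0 < t -> Pi z -> G t z = F t z) /\
  (forall z, Pi z ->
     holomorphic_on (Omega theta1 theta2) (fun zeta => G zeta z)) /\
  (forall zeta1 zeta2 z,
     Omega theta1 theta2 zeta1 -> Omega theta1 theta2 zeta2 -> Pi z ->
     G zeta1 (G zeta2 z) = G (zeta1 + zeta2)%C z).

Definition Sigma_dir (theta : R) (h : C -> C) : Prop :=
  univalent_on Pi h /\
  h 1%C = 0%C /\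
  forall z, Pi z ->
    (forall t, 0 < t -> image Pi h (h z + t * cis theta)%C) /\
    tends_to_infinity (fun t => inv_on Pi h (h z + t * cis theta)%C).

Definition Sigma (theta1 theta2 : R) (h : C -> C) : Prop :=
  forall theta, - theta1 < theta < theta2 -> Sigma_dir theta h.

(* Main.v *)
Require Import Defs.
From Stdlib Require Import Reals Lra ClassicalEpsilon Classical List.
From Coquelicot Require Import Coquelicot.

(** The Koenigs function satisfies [h' = 1 / f], as one sees by differentiating
    [h (F_t z) = h z + t] at [t = 0]. In the coordinate [h] every flow involved
    is a translation: for a direction [e], the orbit of [z] under the field
    [f * e] is [t |-> h^-1 (h z + t e)]. Three facts give the theorem.

    - An analytic extension obeys [d/dzeta G_zeta z = f (G_zeta z)], since the
      complex derivative may be computed along real increments, where [G] is the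
      given semigroup. Hence [h (G_zeta z) - zeta] is constant along circular
      arcs and equals [h z] ([extension_koenigs]); so an extension amounts to
      [h^-1 (h z + zeta)] being defined for all [zeta] in the sector, which
      is the condition on [h].

    - If all orbits in direction [e] stay in the half-plane and tend to infinity,
      then [Re (f * e) >= 0] ([generator_nonneg]). This is Wolff's form of the
      Schwarz lemma at the boundary point infinity: the time-[t] map does not
      decrease the real part ([wolff_lemma]).

    - If [Re (f * e) >= 0], the field [f * e] can be integrated for all positive
      times ([image_ray]). The Schwarz-Pick inequality for [g = f * e] gives
      [Re g' * Re z <= Re g], which says exactly that the hyperbolic
      speed [|g| / Re] is nonincreasing along orbits; therefore an orbit remains in
      a compact part of the half-plane in finite time, and [h z + t e] cannot
      leave the open set [h (Pi)]. As [h] is bounded on compact sets, the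
      orbits tend to infinity ([orbit_tends_to_infinity]).

    The sector condition on [arg f] says that [Re (f * cis theta) >= 0] for all
    [theta] in the open interval ([sector_iff]).

    No integral theorem is used. The Schwarz lemma comes from the elementary
    maximum principle for strictly subharmonic functions, which only requires
    maps with two complex derivatives. All the maps to which it is applied have
    them, because the derivative of [z |-> h^-1 (h z + a)] is
    [f (h^-1 (h z + a)) / f z] and [f] is differentiable. For the Schwarz-Pick
    inequality of [f] itself, whose second derivative is not at hand, one
    uses the maps [(F_t z - z) * e], which have nonnegative real part,
    and lets [t] tend to 0. *)

Open Scope R_scope.

(** * Complex derivatives and extreme values *)

Lemma im_le_Cmod (z : C) : Rabs (Im z) <= Cmod z.
Proof.
eapply Rle_trans; [apply Rmax_r | exact (Rmax_Cmod z)].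
Qed.

Lemma Cmod_le_Re_Im (z : C) : Cmod z <= Rabs (Re z) + Rabs (Im z).
Proof.
assert (H := Cmod2_alt z). assert (H0 := Cmod_ge_0 z).
assert (H1 := Rabs_pos (Re z)). assert (H2 := Rabs_pos (Im z)).
rewrite <- (pow2_abs (Re z)), <- (pow2_abs (Im z)) in H. nra.
Qed.

Lemma Cmod_triangle_rev (z w : C) : Cmod z - Cmod w <= Cmod (z - w)%C.
Proof.
assert (H := Cmod_triangle (z - w)%C w).
replace (z - w + w)%C with z in H by ring. lra.
Qed.

Lemma Cmod_minus_sym (z w : C) : Cmod (z - w)%C = Cmod (w - z)%C.
Proof. rewrite <- Cmod_opp. f_equal. ring. Qed.

Lemma locally_C_Cmod (z : C) (P : C -> Prop) :
  locally z P <->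
  exists d, 0 < d /\ forall w, Cmod (w - z)%C < d -> P w.
Proof.
split; [rewrite locally_C | intros H; rewrite locally_C; revert H].
- intros [d Hd]. exists d. split; [apply cond_pos | exact Hd].
- intros [d [Hd H]]. exists (mkposreal d Hd). exact H.
Qed.

(** The target [C_NormedModule] carries the product topology while the source
    carries the modulus topology; this form makes no reference to either. *)
Lemma is_derive_C_eps (f : C -> C) (z l : C) :
  is_derive f z l <->
  forall eps, 0 < eps -> exists d, 0 < d /\
    forall w, Cmod (w - z)%C < d ->
      Cmod (f w - f z - l * (w - z))%C <= eps * Cmod (w - z)%C.
Proof.
split.
- intros [_ H] eps He.
  destruct (H z (fun P Q => Q) (mkposreal eps He)) as [d Hd].
  exists d. split; [apply cond_pos |].
  intros w Hw. specialize (Hd w Hw).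
  change (Cmod (f w - f z - (w - z) * l)%C <= eps * Cmod (w - z)%C) in Hd.
  replace (l * (w - z))%C with ((w - z) * l)%C by ring. exact Hd.
- intros H. split; [apply is_linear_scal_l |].
  intros y Hy.
  assert (E := @is_filter_lim_locally_unique C_AbsRing (AbsRing_NormedModule C_AbsRing) z y Hy).
  subst y.
  intros eps. destruct (H eps (cond_pos eps)) as [d [Hd H1]].
  exists (mkposreal d Hd). intros w Hw. specialize (H1 w Hw).
  change (Cmod (f w - f z - (w - z) * l)%C <= eps * Cmod (w - z)%C).
  replace ((w - z) * l)%C with (l * (w - z))%C by ring. exact H1.
Qed.

Lemma is_derive_R_eps (u : R -> R) (s l : R) :
  is_derive u s l <->
  forall eps, 0 < eps -> exists d, 0 < d /\
    forall t, Rabs (t - s) < d ->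
      Rabs (u t - u s - l * (t - s)) <= eps * Rabs (t - s).
Proof.
split.
- intros [_ H] eps He.
  destruct (H s (fun P Q => Q) (mkposreal eps He)) as [d Hd].
  exists d. split; [apply cond_pos |].
  intros w Hw. specialize (Hd w Hw).
  change (Rabs (u w - u s - (w - s) * l) <= eps * Rabs (w - s)) in Hd.
  replace (l * (w - s)) with ((w - s) * l) by ring. exact Hd.
- intros H. split; [apply is_linear_scal_l |].
  intros y Hy.
  assert (E := @is_filter_lim_locally_unique R_AbsRing R_NormedModule s y Hy).
  subst y.
  intros eps. destruct (H eps (cond_pos eps)) as [d [Hd H1]].
  exists (mkposreal d Hd). intros w Hw. specialize (H1 w Hw).
  change (Rabs (u w - u s - (w - s) * l) <= eps * Rabs (w - s)).
  replace ((w - s) * l) with (l * (w - s)) by ring. exact H1.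
Qed.

Definition curve_derive (c : R -> C) (s : R) (d : C) : Prop :=
  is_derive (fun t => Re (c t)) s (Re d) /\
  is_derive (fun t => Im (c t)) s (Im d).

Lemma curve_derive_eps (c : R -> C) (s : R) (l : C) :
  curve_derive c s l <->
  forall eps, 0 < eps -> exists d, 0 < d /\
    forall t, Rabs (t - s) < d ->
      Cmod (c t - c s - l * RtoC (t - s))%C <= eps * Rabs (t - s).
Proof.
unfold curve_derive. rewrite !is_derive_R_eps.
assert (HR : forall t, Re (c t - c s - l * RtoC (t - s))%C
   = Re (c t) - Re (c s) - Re l * (t - s)) by (intros; unfold Re, Im; simpl; ring).
assert (HI : forall t, Im (c t - c s - l * RtoC (t - s))%C
   = Im (c t) - Im (c s) - Im l * (t - s)) by (intros; unfold Re, Im; simpl; ring).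
split.
- intros [H1 H2] eps He.
  destruct (H1 (eps / 2)) as [d1 [Hd1 K1]]; [lra |].
  destruct (H2 (eps / 2)) as [d2 [Hd2 K2]]; [lra |].
  exists (Rmin d1 d2). split; [apply Rmin_pos; assumption |].
  intros t Ht.
  specialize (K1 t (Rlt_le_trans _ _ _ Ht (Rmin_l _ _))).
  specialize (K2 t (Rlt_le_trans _ _ _ Ht (Rmin_r _ _))).
  eapply Rle_trans; [apply Cmod_le_Re_Im |]. rewrite HR, HI. lra.
- intros H. split; intros eps He; destruct (H eps He) as [d [Hd K]];
  exists d; (split; [exact Hd |]); intros t Ht; specialize (K t Ht);
  (eapply Rle_trans; [| exact K]).
  + rewrite <- HR. apply re_le_Cmod.
  + rewrite <- HI. apply im_le_Cmod.
Qed.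

Lemma curve_derive_comp (q : C -> C) (c : R -> C) (s : R) (l d : C) :
  is_derive q (c s) l -> curve_derive c s d ->
  curve_derive (fun t => q (c t)) s (l * d)%C.
Proof.
rewrite is_derive_C_eps, !curve_derive_eps. intros Hq Hc eps He.
assert (Hl := Cmod_ge_0 l). assert (Hd0 := Cmod_ge_0 d).
set (A := Cmod l + Cmod d + 1).
assert (HA : 0 < A) by (unfold A; lra).
assert (He' : 0 < Rmin 1 (eps / A)).
{ apply Rmin_pos; [lra |]. apply Rdiv_lt_0_compat; lra. }
set (e := Rmin 1 (eps / A)) in *.
assert (e1 : e <= 1) by apply Rmin_l.
assert (e2 : e * A <= eps).
{ apply Rle_trans with (eps / A * A).
  - apply Rmult_le_compat_r; [lra | apply Rmin_r].
  - right. field. lra. }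
destruct (Hc e He') as [d1 [Hd1 K1]].
destruct (Hq e He') as [d2 [Hd2 K2]].
assert (Hd3 : 0 < d2 / A) by (apply Rdiv_lt_0_compat; lra).
exists (Rmin d1 (d2 / A)). split; [apply Rmin_pos; assumption |].
intros t Ht.
specialize (K1 t (Rlt_le_trans _ _ _ Ht (Rmin_l _ _))).
assert (Ht2 := Rlt_le_trans _ _ _ Ht (Rmin_r _ _)).
assert (Hts := Rabs_pos (t - s)).
assert (Hcc : Cmod (c t - c s)%C <= (Cmod d + e) * Rabs (t - s)).
{ replace (c t - c s)%C
    with ((c t - c s - d * RtoC (t - s)) + d * RtoC (t - s))%C by ring.
  eapply Rle_trans; [apply Cmod_triangle |].
  rewrite Cmod_mult, Cmod_R. lra. }
assert (Hcc2 : Cmod (c t - c s)%C <= A * Rabs (t - s)).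
{ eapply Rle_trans; [exact Hcc |]. apply Rmult_le_compat_r; [lra |].
  unfold A. lra. }
assert (Hlt : Cmod (c t - c s)%C < d2).
{ eapply Rle_lt_trans; [exact Hcc2 |].
  apply Rmult_lt_compat_l with (r := A) in Ht2; [| lra].
  replace (A * (d2 / A)) with d2 in Ht2 by (field; lra). exact Ht2. }
specialize (K2 (c t) Hlt).
replace (q (c t) - q (c s) - l * d * RtoC (t - s))%C with
  ((q (c t) - q (c s) - l * (c t - c s))
   + l * (c t - c s - d * RtoC (t - s)))%C by ring.
eapply Rle_trans; [apply Cmod_triangle |]. rewrite Cmod_mult.
apply Rle_trans with (e * A * Rabs (t - s));
  [| apply Rmult_le_compat_r; lra].
apply Rle_trans with
  (e * ((Cmod d + e) * Rabs (t - s)) + Cmod l * (e * Rabs (t - s))).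
- apply Rplus_le_compat.
  + eapply Rle_trans; [exact K2 |]. apply Rmult_le_compat_l; lra.
  + apply Rmult_le_compat_l; lra.
- replace (e * ((Cmod d + e) * Rabs (t - s)) + Cmod l * (e * Rabs (t - s)))
    with (e * (Cmod d + e + Cmod l) * Rabs (t - s)) by ring.
  apply Rmult_le_compat_r; [lra |]. apply Rmult_le_compat_l; unfold A; lra.
Qed.

Lemma curve_derive_line (z0 e : C) (s : R) :
  curve_derive (fun t => z0 + RtoC t * e)%C s e.
Proof.
split; unfold Re, Im; simpl; auto_derive; trivial; apply Rmult_1_l.
Qed.

(** The two normed modules on [C] differ in their balls only, and derivatives
    depend on the norm alone. This gives access to the generic rules for products
    and compositions, which are stated for the second one. *)
Lemma is_derive_C_AbsRing (f : C -> C) (z l : C) :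
  is_derive f z l <->
  is_derive (V := AbsRing_NormedModule C_AbsRing) f z l.
Proof.
split; intros [_ H]; (split; [apply is_linear_scal_l | exact H]).
Qed.

Lemma is_derive_Cmult (f g : C -> C) (z df dg : C) :
  is_derive f z df -> is_derive g z dg ->
  is_derive (fun w => f w * g w)%C z (df * g z + f z * dg)%C.
Proof.
rewrite !is_derive_C_AbsRing. intros Hf Hg.
apply (is_derive_mult f g z df dg Hf Hg).
intros n m. apply Cmult_comm.
Qed.

Lemma is_derive_Cinv_id (z : C) :
  z <> 0%C -> is_derive Cinv z (- / (z * z))%C.
Proof.
intros Hz. apply is_derive_C_eps. intros eps He.
assert (Hm : 0 < Cmod z) by (apply Cmod_gt_0; exact Hz).
set (m := Cmod z) in *.
set (d := Rmin (m / 2) (eps * m ^ 3 / 2)).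
assert (Hm3 : 0 < m ^ 3) by (apply pow_lt; exact Hm).
assert (Hd : 0 < d) by (apply Rmin_pos; nra).
exists d. split; [exact Hd |]. intros w Hw.
assert (Hw1 := Rlt_le_trans _ _ _ Hw (Rmin_l _ _)).
assert (Hw2 := Rlt_le_trans _ _ _ Hw (Rmin_r _ _)).
assert (Hwm : m / 2 < Cmod w).
{ assert (H := Cmod_triangle_rev z w). rewrite Cmod_minus_sym in H.
  fold m in H. lra. }
assert (Hw0 : w <> 0%C) by (apply Cmod_gt_0; lra).
replace (/ w - / z - - / (z * z) * (w - z))%C
  with ((w - z) * (w - z) / (w * (z * z)))%C by (field; split; assumption).
rewrite Cmod_div by (repeat apply Cmult_neq_0; assumption).
rewrite !Cmod_mult. fold m.
set (x := Cmod (w - z)%C) in *. assert (Hx : 0 <= x) by apply Cmod_ge_0.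
assert (Hp : 0 < Cmod w * (m * m)) by (repeat apply Rmult_lt_0_compat; lra).
apply Rmult_le_reg_r with (Cmod w * (m * m)); [exact Hp |].
unfold Rdiv. rewrite Rmult_assoc, Rinv_l by lra.
rewrite Rmult_1_r.
replace (eps * x * (Cmod w * (m * m))) with (x * (eps * (Cmod w * (m * m)))) by ring.
apply Rmult_le_compat_l; [exact Hx |].
apply Rle_trans with (eps * m ^ 3 / 2); [lra |].
replace (eps * m ^ 3 / 2) with (eps * (m / 2 * (m * m))) by field.
apply Rmult_le_compat_l; [lra |]. apply Rmult_le_compat_r; nra.
Qed.

Lemma is_derive_Cinv (f : C -> C) (z df : C) :
  is_derive f z df -> f z <> 0%C ->
  is_derive (fun w => / f w)%C z (- df / (f z * f z))%C.
Proof.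
intros Hf Hz. apply is_derive_C_AbsRing in Hf.
assert (H := is_derive_comp Cinv f z _ _ (is_derive_Cinv_id (f z) Hz) Hf).
replace (- df / (f z * f z))%C with (scal df (- / (f z * f z)))%C; [exact H |].
change (df * - / (f z * f z) = - df / (f z * f z))%C. field. exact Hz.
Qed.

Lemma continuous_Cmod_derive (q : C -> C) (z : C) :
  ex_derive q z -> continuous (T := C_UniformSpace) (fun w => Cmod (q w)) z.
Proof.
intros [l Hl] P [eps HP].
apply is_derive_C_eps with (eps := 1) in Hl; [| lra].
destruct Hl as [d [Hd H]].
apply locally_C_Cmod.
set (A := Cmod l + 1). assert (HA : 0 < A) by (assert (H0 := Cmod_ge_0 l); unfold A; lra).
assert (Heps := cond_pos eps).
assert (H0 : 0 < eps / A) by (apply Rdiv_lt_0_compat; lra).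
exists (Rmin d (eps / A)). split; [apply Rmin_pos; assumption |].
intros w Hw. apply HP.
change (Rabs (Cmod (q w) - Cmod (q z)) < eps).
assert (Hw1 := Rlt_le_trans _ _ _ Hw (Rmin_l _ _)).
assert (Hw2 := Rlt_le_trans _ _ _ Hw (Rmin_r _ _)).
specialize (H w Hw1).
apply Rle_lt_trans with (Cmod (q w - q z)%C).
{ apply Rabs_le. assert (T1 := Cmod_triangle_rev (q w) (q z)).
  assert (T2 := Cmod_triangle_rev (q z) (q w)).
  rewrite Cmod_minus_sym in T2. lra. }
apply Rle_lt_trans with (A * Cmod (w - z)%C).
- replace (q w - q z)%C with ((q w - q z - l * (w - z)) + l * (w - z))%C by ring.
  eapply Rle_trans; [apply Cmod_triangle |]. rewrite Cmod_mult. unfold A. lra.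
- apply Rmult_lt_compat_l with (r := A) in Hw2; [| lra].
  replace (A * (eps / A)) with (pos eps) in Hw2 by (field; lra). exact Hw2.
Qed.

Lemma finite_argmax {T : Type} (g : T -> R) (l : list T) :
  l <> nil -> exists t, In t l /\ forall s, In s l -> g s <= g t.
Proof.
induction l as [| a l IH]; [congruence |]. intros _.
destruct (classic (l = nil)) as [-> | Hl].
- exists a. split; [left; reflexivity |]. intros s [<- | []]. lra.
- destruct (IH Hl) as [t [Ht H]].
  destruct (Rle_dec (g a) (g t)) as [Hat | Hat].
  + exists t. split; [right; exact Ht |]. intros s [<- | Hs]; auto.
  + exists a. split; [left; reflexivity |].
    intros s [<- | Hs]; [lra |]. specialize (H s Hs). lra.
Qed.

(** If no point were maximal, each point of the plane would have a neighbourhood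
    on which [v] stays below one of its values on [K]. Finitely many of
    these neighbourhoods cover [K], and the largest of the corresponding values is
    then below itself. *)
Lemma extreme_value (K : C -> Prop) (v : C -> R) (M : R) :
  (forall z, K z -> Cmod z <= M) ->
  closed (T := C_UniformSpace) K ->
  (forall z, K z -> continuous (T := C_UniformSpace) v z) ->
  (exists z, K z) ->
  exists m, K m /\ forall z, K z -> v z <= v m.
Proof.
intros Hbd Hcl Hc [z0 Hz0]. apply NNPP. intros Hno.
assert (Hbig : forall u, K u -> exists u', K u' /\ v u < v u').
{ intros u Hu. apply NNPP. intros H. apply Hno. exists u. split; [exact Hu |].
  intros z Hz. apply Rnot_lt_le. intros Hlt. apply H. exists z. auto. }
assert (Hloc : forall u : C, exists p : posreal * C, K (snd p) /\
  forall w, K w -> Rabs (Re w - Re u) < fst p -> Rabs (Im w - Im u) < fst p ->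
    v w < v (snd p)).
{ intros u.
  assert (Hnear : exists u', K u' /\
    locally (T := C_UniformSpace) u (fun w => K w -> v w < v u')).
  { destruct (classic (K u)) as [Hu | Hu].
    - destruct (Hbig u Hu) as [u' [Hu' Hlt]]. exists u'. split; [exact Hu' |].
      assert (Hn : locally (v u) (fun y => y < v u')).
      { apply (open_lt (v u')). exact Hlt. }
      specialize (Hc u Hu _ Hn). unfold filtermap in Hc.
      revert Hc. apply filter_imp. auto.
    - exists z0. split; [exact Hz0 |]. apply NNPP. intros Hn. apply Hu.
      apply Hcl. intros Hl. apply Hn. revert Hl. apply filter_imp.
      intros w H1 H2. contradiction. }
  destruct Hnear as [u' [Hu' [d Hd]]]. exists (d, u'). split; [exact Hu' |].
  simpl. intros w Kw H1 H2. apply Hd; [| exact Kw]. split; assumption. }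
set (ch := fun u => proj1_sig (constructive_indefinite_description _ (Hloc u))).
assert (Hch : forall u, K (snd (ch u)) /\
  forall w, K w -> Rabs (Re w - Re u) < fst (ch u) ->
    Rabs (Im w - Im u) < fst (ch u) -> v w < v (snd (ch u))).
{ intros u. exact (proj2_sig (constructive_indefinite_description _ (Hloc u))). }
set (pt := fun t : Compactness.Tn 2 R => (fst t, fst (snd t)) : C).
apply (compactness_list 2 (- M, (- M, tt)) (M, (M, tt)) (fun t => fst (ch (pt t)))).
intros [l Hl].
assert (Hcov : forall z, K z -> exists t, In t l /\ v z < v (snd (ch (pt t)))).
{ intros z Hz. assert (Hm := Hbd z Hz).
  assert (H1 := re_le_Cmod z). assert (H2 := im_le_Cmod z).
  assert (H3 := Rabs_le_between (Re z) M). assert (H4 := Rabs_le_between (Im z) M).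
  destruct (Hl (Re z, (Im z, tt))) as [t [Ht [_ Hct]]].
  { simpl. repeat split; try (apply H3; lra); apply H4; lra. }
  exists t. split; [exact Ht |].
  destruct t as [t1 [t2 t3]]. destruct Hct as [C1 [C2 _]].
  apply Hch; assumption. }
destruct (finite_argmax (fun t => v (snd (ch (pt t)))) l) as [t [Ht Hmax]].
{ destruct (Hcov z0 Hz0) as [t [Ht _]]. intros ->. exact Ht. }
destruct (Hcov (snd (ch (pt t))) (proj1 (Hch (pt t)))) as [s [Hs Hlt]].
specialize (Hmax s Hs). lra.
Qed.

(** * Maps with two complex derivatives *)

(** Two derivatives are what the second derivative test needs. *)
Definition twice_holomorphic_on (D : C -> Prop) (q : C -> C) : Prop :=
  exists q1 : C -> C,
    forall z, D z -> is_derive q z (q1 z) /\ ex_derive q1 z.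

Lemma is_derive_C_const (a z : C) : is_derive (fun _ : C => a) z (RtoC 0).
Proof. exact (is_derive_const (V := C_NormedModule) a z). Qed.

Lemma is_derive_C_id (z : C) : is_derive (fun w : C => w) z (RtoC 1).
Proof. apply is_derive_C_AbsRing. exact (is_derive_id (K := C_AbsRing) z). Qed.

Lemma twice_holomorphic_const (D : C -> Prop) (a : C) :
  twice_holomorphic_on D (fun _ => a).
Proof.
exists (fun _ => RtoC 0). intros z _.
split; [| exists (RtoC 0)]; apply is_derive_C_const.
Qed.

Lemma twice_holomorphic_id (D : C -> Prop) :
  twice_holomorphic_on D (fun z => z).
Proof.
exists (fun _ => RtoC 1). intros z _. split; [apply is_derive_C_id |].
exists (RtoC 0). apply is_derive_C_const.
Qed.

Lemma twice_holomorphic_plus (D : C -> Prop) (p q : C -> C) :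
  twice_holomorphic_on D p -> twice_holomorphic_on D q ->
  twice_holomorphic_on D (fun z => p z + q z)%C.
Proof.
intros [p1 Hp] [q1 Hq]. exists (fun z => p1 z + q1 z)%C. intros z Hz.
destruct (Hp z Hz) as [P1 [p2 P2]]. destruct (Hq z Hz) as [Q1 [q2 Q2]].
split; [exact (is_derive_plus _ _ _ _ _ P1 Q1) |].
exists (plus p2 q2). exact (is_derive_plus _ _ _ _ _ P2 Q2).
Qed.

Lemma twice_holomorphic_mult (D : C -> Prop) (p q : C -> C) :
  twice_holomorphic_on D p -> twice_holomorphic_on D q ->
  twice_holomorphic_on D (fun z => p z * q z)%C.
Proof.
intros [p1 Hp] [q1 Hq]. exists (fun z => p1 z * q z + p z * q1 z)%C.
intros z Hz.
destruct (Hp z Hz) as [P1 [p2 P2]]. destruct (Hq z Hz) as [Q1 [q2 Q2]].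
split; [exact (is_derive_Cmult _ _ _ _ _ P1 Q1) |].
eexists. exact (is_derive_plus _ _ _ _ _
  (is_derive_Cmult _ _ _ _ _ P2 Q1) (is_derive_Cmult _ _ _ _ _ P1 Q2)).
Qed.

Lemma twice_holomorphic_inv (D : C -> Prop) (p : C -> C) :
  twice_holomorphic_on D p -> (forall z, D z -> p z <> 0%C) ->
  twice_holomorphic_on D (fun z => / p z)%C.
Proof.
intros [p1 Hp] H0. exists (fun z => - p1 z * / (p z * p z))%C. intros z Hz.
destruct (Hp z Hz) as [P1 [p2 P2]]. specialize (H0 z Hz).
split; [exact (is_derive_Cinv _ _ _ P1 H0) |].
eexists. apply is_derive_Cmult.
- exact (is_derive_opp _ _ _ P2).
- apply is_derive_Cinv; [exact (is_derive_Cmult _ _ _ _ _ P1 P1) |].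
  apply Cmult_neq_0; exact H0.
Qed.

Lemma is_derive_C_comp (p q : C -> C) (z dp dq : C) :
  is_derive p (q z) dp -> is_derive q z dq ->
  is_derive (fun w => p (q w)) z (dp * dq)%C.
Proof.
intros Hp Hq. apply is_derive_C_AbsRing in Hq.
assert (H := is_derive_comp p q z _ _ Hp Hq).
rewrite Cmult_comm. exact H.
Qed.

Lemma twice_holomorphic_comp (D E : C -> Prop) (p q : C -> C) :
  twice_holomorphic_on E p -> twice_holomorphic_on D q ->
  (forall z, D z -> E (q z)) ->
  twice_holomorphic_on D (fun z => p (q z)).
Proof.
intros [p1 Hp] [q1 Hq] HE. exists (fun z => p1 (q z) * q1 z)%C. intros z Hz.
destruct (Hp (q z) (HE z Hz)) as [P1 [p2 P2]].
destruct (Hq z Hz) as [Q1 [q2 Q2]].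
split; [exact (is_derive_C_comp _ _ _ _ _ P1 Q1) |].
eexists. apply is_derive_Cmult; [| exact Q2].
exact (is_derive_C_comp _ _ _ _ _ P2 Q1).
Qed.

(** A positive second derivative makes [A1] positive on the right of [s] or
    negative on the left, according to the sign of [A1 s]; in both cases [A]
    exceeds [A s] nearby. *)
Lemma second_derivative_at_max (A A1 : R -> R) (s a : R) :
  locally s (fun t => is_derive A t (A1 t)) -> is_derive A1 s a ->
  locally s (fun t => A t <= A s) -> a <= 0.
Proof.
intros HA HA1 Hmax. apply Rnot_lt_le. intros Ha.
destruct (filter_and _ _ HA Hmax) as [d1 Hd1].
assert (H := proj1 (is_derive_R_eps A1 s a) HA1).
destruct (H (a / 2)) as [d2 [Hd2 H2]]; [lra |]. clear H.
assert (P1 := cond_pos d1).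
set (d := Rmin d1 d2). assert (Hd : 0 < d) by (apply Rmin_pos; assumption).
assert (Hnear : forall t, Rabs (t - s) < d ->
  is_derive A t (A1 t) /\ A t <= A s /\
  Rabs (A1 t - A1 s - a * (t - s)) <= a / 2 * Rabs (t - s)).
{ intros t Ht.
  destruct (Hd1 t (Rlt_le_trans _ _ _ Ht (Rmin_l _ _))) as [B1 B2].
  split; [exact B1 |]. split; [exact B2 |].
  exact (H2 t (Rlt_le_trans _ _ _ Ht (Rmin_r _ _))). }
(* If A1 s >= 0 then A increases strictly to the right of s; otherwise it
   decreases strictly to the left of s. *)
destruct (Rle_dec 0 (A1 s)) as [Hm | Hm].
- destruct (MVT_cor2 A A1 s (s + d / 2)) as [c [Hc1 Hc2]]; [lra | |].
  + intros x Hx. apply is_derive_Reals. apply Hnear. rewrite Rabs_pos_eq; lra.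
  + destruct (Hnear (s + d / 2)) as [_ [E1 _]]; [rewrite Rabs_pos_eq; lra |].
    destruct (Hnear c) as [_ [_ E2]]; [rewrite Rabs_pos_eq; lra |].
    rewrite (Rabs_pos_eq (c - s)) in E2 by lra. apply Rabs_le_between in E2.
    assert (0 < A1 c) by nra. nra.
- destruct (MVT_cor2 A A1 (s - d / 2) s) as [c [Hc1 Hc2]]; [lra | |].
  + intros x Hx. apply is_derive_Reals. apply Hnear. rewrite Rabs_left1; lra.
  + destruct (Hnear (s - d / 2)) as [_ [E1 _]]; [rewrite Rabs_left1; lra |].
    destruct (Hnear c) as [_ [_ E2]]; [rewrite Rabs_left1; lra |].
    rewrite (Rabs_left1 (c - s)) in E2 by lra. apply Rabs_le_between in E2.
    assert (A1 c < 0) by nra. nra.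
Qed.

(** * The maximum principle with a logarithmic barrier *)

(** The second term makes the function strictly subharmonic. The logarithm is
    harmonic and tends to minus infinity at 0, so it pushes the maximum away from
    a puncture at 0. *)
Definition barrier (q : C -> C) (eps del : R) (z : C) : R :=
  Cmod (q z) ^ 2 + eps * Cmod z ^ 2 + del * ln (Cmod z ^ 2).

Lemma locally_line (z e : C) (P : C -> Prop) :
  locally z P -> locally 0 (fun t : R => P (z + RtoC t * e)%C).
Proof.
intros H. apply locally_C_Cmod in H. destruct H as [d [Hd H]].
assert (He := Cmod_ge_0 e).
assert (Hp : 0 < d / (Cmod e + 1)) by (apply Rdiv_lt_0_compat; lra).
exists (mkposreal _ Hp). intros t Ht. apply H.
change (Rabs (t - 0) < d / (Cmod e + 1)) in Ht. rewrite Rminus_0_r in Ht.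
replace (z + t * e - z)%C with (t * e)%C by ring.
rewrite Cmod_mult, Cmod_R.
apply Rle_lt_trans with (Rabs t * (Cmod e + 1)).
- apply Rmult_le_compat_l; [apply Rabs_pos | lra].
- apply Rmult_lt_compat_r with (r := Cmod e + 1) in Ht; [| lra].
  replace (d / (Cmod e + 1) * (Cmod e + 1)) with d in Ht by (field; lra).
  exact Ht.
Qed.

(** The left-hand side is half the second derivative of the barrier at [z] in
    the direction [e]. *)
Lemma barrier_second_derivative (q q1 : C -> C) (q2 z e : C) (eps del : R) :
  z <> 0%C ->
  locally z (fun w => is_derive q w (q1 w)) -> is_derive q1 z q2 ->
  locally z (fun w => barrier q eps del w <= barrier q eps del z) ->
  Cmod (q1 z * e)%C ^ 2
    + (Re (q z) * Re (q2 * e * e)%C + Im (q z) * Im (q2 * e * e)%C)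
    + eps * Cmod e ^ 2
    + del * (Cmod e ^ 2 / Cmod z ^ 2
             - 2 * (Re z * Re e + Im z * Im e) ^ 2 / Cmod z ^ 4) <= 0.
Proof.
intros Hz Hq Hq1 Hmax.
set (c := fun t : R => (z + RtoC t * e)%C).
assert (c0 : c 0 = z) by (unfold c; ring).
assert (Hcre : forall t, Re (c t) = Re z + t * Re e)
  by (intros t; unfold c, Re, Im; simpl; ring).
assert (Hcim : forall t, Im (c t) = Im z + t * Im e)
  by (intros t; unfold c, Re, Im; simpl; ring).
set (U := fun t => Re (q (c t))). set (V := fun t => Im (q (c t))).
set (U1 := fun t => Re (q1 (c t) * e)%C). set (V1 := fun t => Im (q1 (c t) * e)%C).
set (n := fun t => (Re z + t * Re e) ^ 2 + (Im z + t * Im e) ^ 2).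
set (A := fun t => U t ^ 2 + V t ^ 2 + eps * n t + del * ln (n t)).
set (n1 := fun t => 2 * (Re z + t * Re e) * Re e + 2 * (Im z + t * Im e) * Im e).
set (A1 := fun t => 2 * U t * U1 t + 2 * V t * V1 t + eps * n1 t + del * (n1 t / n t)).
assert (HA : forall t, A t = barrier q eps del (c t)).
{ intros t. unfold A, barrier, n, U, V.
  rewrite !Cmod2_alt, Hcre, Hcim. reflexivity. }
assert (HUV : locally 0 (fun t => is_derive U t (U1 t) /\ is_derive V t (V1 t))).
{ generalize (locally_line z e _ Hq). apply filter_imp. intros t Ht.
  exact (curve_derive_comp q c t _ e Ht (curve_derive_line z e t)). }
assert (HUV1 : is_derive U1 0 (Re (q2 * e * e)%C) /\
               is_derive V1 0 (Im (q2 * e * e)%C)).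
{ apply (curve_derive_comp (fun w => q1 w * e)%C c 0 (q2 * e)%C e).
  - rewrite c0. replace (q2 * e)%C with (q2 * e + q1 z * 0)%C by ring.
    apply is_derive_Cmult; [exact Hq1 | apply is_derive_C_const].
  - apply curve_derive_line. }
assert (Hn : locally 0 (fun t => 0 < n t)).
{ assert (Hl : locally z (fun w => 0 < Cmod w)).
  { apply locally_C_Cmod. exists (Cmod z).
    split; [apply Cmod_gt_0; exact Hz |]. intros w Hw.
    assert (H := Cmod_triangle_rev z w). rewrite Cmod_minus_sym in H. lra. }
  generalize (locally_line z e _ Hl). apply filter_imp. intros t Ht.
  fold (c t) in Ht. unfold n. rewrite <- Hcre, <- Hcim, <- Cmod2_alt.
  apply pow_lt. exact Ht. }
assert (Hn1 : forall t, is_derive n t (n1 t)).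
{ intros t. unfold n, n1. auto_derive; trivial. ring. }
assert (HdA : locally 0 (fun t => is_derive A t (A1 t))).
{ generalize (filter_and _ _ HUV Hn). apply filter_imp.
  intros t [[HU HV] Hnt]. unfold A, A1. specialize (Hn1 t).
  evar_last.
  - apply (is_derive_plus (V := R_NormedModule));
      [apply (is_derive_plus (V := R_NormedModule));
         [apply (is_derive_plus (V := R_NormedModule)) |] |].
    + apply is_derive_pow. exact HU.
    + apply is_derive_pow. exact HV.
    + apply is_derive_scal. exact Hn1.
    + apply is_derive_scal. apply (is_derive_comp (V := R_NormedModule) ln n).
      * apply is_derive_ln. exact Hnt.
      * exact Hn1.
  - unfold plus, scal, mult; simpl. unfold mult; simpl. field. lra. }
assert (Hn0 : 0 < n 0) by (exact (locally_singleton _ _ Hn)).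
assert (HdA1 : is_derive A1 0
  (2 * (U1 0 ^ 2 + V1 0 ^ 2 + (U 0 * Re (q2 * e * e)%C + V 0 * Im (q2 * e * e)%C)
   + eps * Cmod e ^ 2 + del * (Cmod e ^ 2 / n 0 - n1 0 ^ 2 / (2 * n 0 ^ 2))))).
{ destruct (locally_singleton _ _ HUV) as [HU HV]. destruct HUV1 as [HU1 HV1].
  assert (Hn2 : is_derive n1 0 (2 * Cmod e ^ 2)).
  { rewrite Cmod2_alt. unfold n1. auto_derive; trivial. ring. }
  unfold A1. evar_last.
  - apply (is_derive_plus (V := R_NormedModule));
      [apply (is_derive_plus (V := R_NormedModule));
         [apply (is_derive_plus (V := R_NormedModule)) |] |].
    + apply Derive.is_derive_mult; [apply is_derive_scal; exact HU | exact HU1].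
    + apply Derive.is_derive_mult; [apply is_derive_scal; exact HV | exact HV1].
    + apply is_derive_scal. exact Hn2.
    + apply is_derive_scal. apply is_derive_div; [exact Hn2 | apply Hn1 | lra].
  - unfold plus; simpl. field. lra. }
assert (HAmax : locally 0 (fun t => A t <= A 0)).
{ generalize (locally_line z e _ Hmax). apply filter_imp. intros t Ht.
  rewrite !HA, c0. exact Ht. }
assert (Hfin := second_derivative_at_max A A1 0 _ HdA HdA1 HAmax).
assert (E0 : n 0 = Cmod z ^ 2) by (unfold n; rewrite Cmod2_alt; ring).
assert (E1 : n1 0 = 2 * (Re z * Re e + Im z * Im e)) by (unfold n1; ring).
rewrite E0, E1 in Hfin. rewrite E0 in Hn0.
rewrite (Cmod2_alt (q1 z * e)%C).
unfold U, V, U1, V1 in Hfin. rewrite c0 in Hfin.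
replace (2 * (Re z * Re e + Im z * Im e) ^ 2 / Cmod z ^ 4) with
  ((2 * (Re z * Re e + Im z * Im e)) ^ 2 / (2 * (Cmod z ^ 2) ^ 2))
  by (field; assert (H := proj1 (Cmod_gt_0 z) Hz); lra).
lra.
Qed.

(** Adding the second derivatives in the directions [1] and [Ci] gives the
    Laplacian: the terms in [q2] and the logarithmic terms cancel, and
    [4 |q1|^2 + 4 eps > 0] remains. *)
Lemma barrier_no_local_max (q q1 : C -> C) (q2 z : C) (eps del : R) :
  z <> 0%C -> 0 < eps ->
  locally z (fun w => is_derive q w (q1 w)) -> is_derive q1 z q2 ->
  ~ locally z (fun w => barrier q eps del w <= barrier q eps del z).
Proof.
intros Hz He Hq Hq1 Hmax.
assert (H1 := barrier_second_derivative q q1 q2 z 1%C eps del Hz Hq Hq1 Hmax).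
assert (Hi := barrier_second_derivative q q1 q2 z Ci eps del Hz Hq Hq1 Hmax).
assert (Hm : 0 < Cmod z) by (apply Cmod_gt_0; exact Hz).
assert (Hz2 := Cmod2_alt z).
replace (Re (1%C)) with 1 in H1 by reflexivity.
replace (Im (1%C)) with 0 in H1 by reflexivity.
replace (Re Ci) with 0 in Hi by reflexivity.
replace (Im Ci) with 1 in Hi by reflexivity.
replace (q2 * 1 * 1)%C with q2 in H1 by ring.
replace (q2 * Ci * Ci)%C with (- q2)%C in Hi
  by (apply injective_projections; simpl; ring).
rewrite !Cmod_mult, !Cmod_1 in H1. rewrite !Cmod_mult, !Cmod_Ci in Hi.
replace (Re (- q2)%C) with (- Re q2) in Hi by reflexivity.
replace (Im (- q2)%C) with (- Im q2) in Hi by reflexivity.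
assert (Hs : 1 ^ 2 / Cmod z ^ 2 - 2 * (Re z * 1 + Im z * 0) ^ 2 / Cmod z ^ 4
  + (1 ^ 2 / Cmod z ^ 2 - 2 * (Re z * 0 + Im z * 1) ^ 2 / Cmod z ^ 4) = 0).
{ replace (Cmod z ^ 4) with ((Cmod z ^ 2) ^ 2) by ring.
  assert (0 < Cmod z ^ 2) by (apply pow_lt; exact Hm).
  rewrite Hz2 in *. field. lra. }
assert (0 <= Cmod (q1 z) ^ 2) by (apply pow2_ge_0).
nra.
Qed.

(** * The Schwarz lemma and the Schwarz-Pick inequality *)

Lemma continuous_Cmod_id (z : C) : continuous (T := C_UniformSpace) Cmod z.
Proof.
apply (continuous_Cmod_derive (fun w => w)). exists (RtoC 1). apply is_derive_C_id.
Qed.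

Lemma continuous_barrier (q : C -> C) (eps del : R) (z : C) :
  z <> 0%C -> ex_derive q z ->
  continuous (T := C_UniformSpace) (barrier q eps del) z.
Proof.
intros Hz Hq.
assert (Hsq : forall u : C -> R, continuous (T := C_UniformSpace) u z ->
  continuous (T := C_UniformSpace) (fun w => u w ^ 2) z).
{ intros u Hu. apply (continuous_ext (fun w => mult (u w) (u w))).
  - intros w. unfold mult; simpl. ring.
  - apply (continuous_mult (K := R_AbsRing)); exact Hu. }
unfold barrier.
apply (continuous_plus (V := R_NormedModule));
  [apply (continuous_plus (V := R_NormedModule)) |].
- apply Hsq. apply continuous_Cmod_derive. exact Hq.
- apply (continuous_scal_r (V := R_NormedModule)). apply Hsq.
  apply continuous_Cmod_id.
- apply (continuous_scal_r (V := R_NormedModule)).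
  apply (@continuous_comp C_UniformSpace R_UniformSpace R_UniformSpace
    (fun w => Cmod w ^ 2) ln).
  + apply Hsq. apply continuous_Cmod_id.
  + apply (ex_derive_continuous (V := R_NormedModule)).
    exists (/ Cmod z ^ 2). apply is_derive_ln. apply pow_lt.
    apply Cmod_gt_0. exact Hz.
Qed.

Lemma closed_annulus (a b : R) :
  closed (T := C_UniformSpace) (fun z => a <= Cmod z /\ Cmod z <= b).
Proof.
apply closed_and.
- apply (closed_comp (U := R_UniformSpace) Cmod (fun x => a <= x));
    [exact continuous_Cmod_id | apply closed_ge].
- apply (closed_comp (U := R_UniformSpace) Cmod (fun x => x <= b));
    [exact continuous_Cmod_id | apply closed_le].
Qed.

Lemma barrier_le_max (q : C -> C) (eps del a b : R) (u : C) :
  0 < a -> 0 < eps ->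
  twice_holomorphic_on (fun z => a <= Cmod z <= b) q ->
  a <= Cmod u <= b ->
  exists m, (Cmod m = a \/ Cmod m = b) /\
    barrier q eps del u <= barrier q eps del m.
Proof.
intros Ha He [q1 Hq] Hu.
assert (Hnz : forall z, a <= Cmod z <= b -> z <> 0%C).
{ intros z Hz. apply Cmod_gt_0. lra. }
destruct (extreme_value (fun z => a <= Cmod z /\ Cmod z <= b)
            (barrier q eps del) b) as [m [Hm Hmax]].
- intros z Hz. apply Hz.
- apply closed_annulus.
- intros z Hz. apply continuous_barrier; [apply Hnz; exact Hz |].
  exists (q1 z). apply Hq. exact Hz.
- exists u. exact Hu.
- exists m. split; [| apply Hmax; exact Hu].
  destruct (Req_dec (Cmod m) a) as [| Hma]; [left; assumption | right].
  apply NNPP. intros Hmb.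
  assert (Hnear : locally m (fun w => a <= Cmod w <= b)).
  { apply locally_C_Cmod. exists (Rmin (Cmod m - a) (b - Cmod m)).
    split; [apply Rmin_pos; lra |]. intros w Hw.
    assert (T1 := Cmod_triangle_rev m w). rewrite Cmod_minus_sym in T1.
    assert (T2 := Cmod_triangle_rev w m).
    assert (M1 := Rmin_l (Cmod m - a) (b - Cmod m)).
    assert (M2 := Rmin_r (Cmod m - a) (b - Cmod m)). lra. }
  destruct (Hq m Hm) as [_ [q2 Hq2]].
  apply (barrier_no_local_max q q1 q2 m eps del (Hnz m Hm) He).
  + revert Hnear. apply filter_imp. intros w Hw. apply Hq. exact Hw.
  + exact Hq2.
  + revert Hnear. apply filter_imp. exact Hmax.
Qed.

(** The quotient [q z = g z / z] is bounded near 0 because [g] is differentiable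
    there. On an annulus [a <= |z| <= r] the barrier takes its maximum on the
    boundary, and for small [a] not on the inner circle, so that at [u] it is at
    most [1 / r^2 + eps]. Letting [del], [eps] tend to 0 and [r] to 1
    gives [|q u| <= 1]; the limits are replaced below by explicit choices. *)
Lemma schwarz_lemma (g : C -> C) :
  twice_holomorphic_on (fun z => Cmod z < 1) g ->
  g 0%C = 0%C ->
  (forall z, Cmod z < 1 -> Cmod (g z) <= 1) ->
  forall u, Cmod u < 1 -> Cmod (g u) <= Cmod u.
Proof.
intros Hg Hg0 Hg1 u Hu. apply Rnot_lt_le. intros Hlt.
assert (Hunz : u <> 0%C).
{ intros ->. rewrite Hg0 in Hlt. lra. }
assert (Hu0 : 0 < Cmod u) by (apply Cmod_gt_0; exact Hunz).
set (q := fun z => (g z * / z)%C).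
assert (Hqm : forall z : C, z <> 0%C -> Cmod (q z) = Cmod (g z) / Cmod z).
{ intros z Hz. unfold q. rewrite Cmod_mult, Cmod_inv by exact Hz. reflexivity. }
(* The excess gap of |q u|^2 over 1 is shared out between the error terms. *)
set (gap := Cmod (q u) ^ 2 - 1).
assert (Hgap : 0 < gap).
{ unfold gap. rewrite Hqm by exact Hunz.
  assert (1 < Cmod (g u) / Cmod u).
  { apply Rmult_lt_reg_r with (Cmod u); [lra |]. unfold Rdiv.
    rewrite Rmult_assoc, Rinv_l by lra. lra. }
  nra. }
(* As (1 - s)^-2 <= 1 + 6 s for s <= 1/2, the bound gap / 24 makes the error of
   1 / r^2 at most gap / 4. *)
set (s := Rmin (1 / 2) (Rmin (gap / 24) ((1 - Cmod u) / 2))).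
assert (s1 : s <= 1 / 2) by apply Rmin_l.
assert (s2 : s <= gap / 24)
  by (eapply Rle_trans; [apply Rmin_r | apply Rmin_l]).
assert (s3 : s <= (1 - Cmod u) / 2)
  by (eapply Rle_trans; [apply Rmin_r | apply Rmin_r]).
assert (s0 : 0 < s) by (repeat apply Rmin_pos; lra).
set (r := 1 - s).
assert (Hr2 : / r ^ 2 <= 1 + gap / 4).
{ apply Rmult_le_reg_l with (r ^ 2); [apply pow_lt; unfold r; lra |].
  rewrite Rinv_r by (unfold r; nra).
  assert (0 <= s * ((1 - 2 * s) * (4 - 3 * s)))
    by (apply Rmult_le_pos; [| apply Rmult_le_pos]; lra).
  apply Rle_trans with ((1 - s) ^ 2 * (1 + 6 * s)); [lra |].
  unfold r. apply Rmult_le_compat_l; [nra | lra]. }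
assert (Hlnu : ln (Cmod u ^ 2) < 0).
{ rewrite <- ln_1. apply ln_increasing; nra. }
set (eps := gap / 4).
set (del := gap / 4 / (1 - ln (Cmod u ^ 2))).
assert (Hdel : 0 < del) by (apply Rdiv_lt_0_compat; lra).
assert (Hdelu : - gap / 4 < del * ln (Cmod u ^ 2)).
{ assert (del * (1 - ln (Cmod u ^ 2)) = gap / 4)
    by (unfold del; field; lra). lra. }
destruct Hg as [g1 Hg].
assert (Hder : is_derive g (RtoC 0) (g1 0%C)).
{ apply Hg. rewrite Cmod_0. lra. }
destruct (proj1 (is_derive_C_eps _ _ _) Hder 1) as [d [Hd Hd1]]; [lra |].
set (M := Cmod (g1 0%C) + 1).
assert (HM : forall z : C, z <> 0%C -> Cmod z < d -> Cmod (q z) <= M).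
{ intros z Hz Hzd. assert (Hz0 := proj1 (Cmod_gt_0 z) Hz).
  specialize (Hd1 z). rewrite Hg0 in Hd1.
  replace (z - 0)%C with z in Hd1 by ring. specialize (Hd1 Hzd).
  rewrite Hqm by exact Hz. apply Rmult_le_reg_r with (Cmod z); [lra |].
  unfold Rdiv. rewrite Rmult_assoc, Rinv_l by lra.
  assert (T := Cmod_triangle (g z - 0 - g1 0 * z)%C (g1 0 * z)%C).
  replace (g z - 0 - g1 0 * z + g1 0 * z)%C with (g z) in T by ring.
  rewrite Cmod_mult in T. unfold M. lra. }
(* On the circle of radius a <= exp (- B) the logarithm outweighs M^2. *)
set (B := (M ^ 2 + 1) / del).
set (a := Rmin (d / 2) (Rmin (Cmod u) (exp (- B)))).
assert (Ha0 : 0 < a).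
{ repeat apply Rmin_pos; try lra. apply exp_pos. }
assert (a1 : a <= d / 2) by apply Rmin_l.
assert (a2 : a <= Cmod u) by (eapply Rle_trans; [apply Rmin_r | apply Rmin_l]).
assert (a3 : a <= exp (- B)) by (eapply Rle_trans; [apply Rmin_r | apply Rmin_r]).
assert (Hlna : del * ln (a ^ 2) <= - 2 * (M ^ 2 + 1)).
{ assert (ln a <= - B).
  { rewrite <- (ln_exp (- B)). destruct a3 as [a3 | ->]; [| lra].
    left. apply ln_increasing; lra. }
  replace (ln (a ^ 2)) with (2 * ln a)
    by (simpl; rewrite Rmult_1_r, ln_mult by lra; ring).
  replace (M ^ 2 + 1) with (del * B) by (unfold B; field; lra). nra. }
destruct (barrier_le_max q eps del a r u Ha0) as [m [Hm Hle]].
- unfold eps. lra.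
- apply twice_holomorphic_mult.
  + exists g1. intros z Hz. apply Hg. unfold r in Hz. lra.
  + apply twice_holomorphic_inv; [apply twice_holomorphic_id |].
    intros z Hz. apply Cmod_gt_0. lra.
- unfold r. lra.
- assert (Hlow : 1 + gap + - gap / 4 < barrier q eps del u).
  { unfold barrier. assert (0 <= eps * Cmod u ^ 2).
    { apply Rmult_le_pos; [unfold eps; lra | apply pow2_ge_0]. }
    unfold gap at 1. lra. }
  destruct Hm as [Hm | Hm].
  + assert (Hmz : m <> 0%C) by (apply Cmod_gt_0; lra).
    assert (Hup : barrier q eps del m <= M ^ 2 + eps + - 2 * (M ^ 2 + 1)).
    { unfold barrier. rewrite Hm.
      assert (H1 : Cmod (q m) <= M) by (apply HM; [exact Hmz | lra]).
      assert (H2 := Cmod_ge_0 (q m)).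
      assert (Cmod (q m) ^ 2 <= M ^ 2) by (apply pow_incr; lra).
      assert (a ^ 2 <= 1) by nra.
      assert (eps * a ^ 2 <= eps) by (unfold eps; nra). lra. }
    assert (0 <= M ^ 2) by apply pow2_ge_0. unfold eps in *. lra.
  + assert (Hmz : m <> 0%C) by (apply Cmod_gt_0; unfold r in Hm; lra).
    assert (Hr : 0 < r < 1) by (unfold r; lra).
    assert (Hup : barrier q eps del m <= / r ^ 2 + eps).
    { unfold barrier. rewrite Hqm, Hm by exact Hmz.
      assert (H1 : Cmod (g m) <= 1) by (apply Hg1; lra).
      assert (H2 := Cmod_ge_0 (g m)).
      assert (Hi : 0 < / r ^ 2) by (apply Rinv_0_lt_compat, pow_lt; lra).
      assert ((Cmod (g m) / r) ^ 2 <= / r ^ 2).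
      { replace ((Cmod (g m) / r) ^ 2) with (Cmod (g m) ^ 2 * / r ^ 2)
          by (field; lra).
        assert (Cmod (g m) ^ 2 <= 1) by nra.
        rewrite <- (Rmult_1_l (/ r ^ 2)) at 2.
        apply Rmult_le_compat_r; lra. }
      assert (ln (r ^ 2) < 0).
      { rewrite <- ln_1. apply ln_increasing; nra. }
      assert (eps * r ^ 2 <= eps).
      { rewrite <- (Rmult_1_r eps) at 2. apply Rmult_le_compat_l; [unfold eps; lra | nra]. }
      assert (del * ln (r ^ 2) < 0) by nra. lra. }
    unfold eps in *. lra.
Qed.

Lemma Re_mult_inv (n d : C) :
  d <> 0%C ->
  Re (n * / d)%C * Cmod d ^ 2 = Re n * Re d + Im n * Im d.
Proof.
intros Hd. assert (H := pow_lt _ 2 (proj1 (Cmod_gt_0 d) Hd)).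
rewrite Cmod2_alt in *. destruct n as [a b], d as [x y].
unfold Re, Im in *; simpl in *. field. lra.
Qed.

(** Source of the Schwarz-Pick inequality in the half-plane: it expresses the
    pseudo-hyperbolic distance [|z - w| / |z + conj w|] through [|z - w|^2] and
    the product of the real parts. *)
Lemma half_plane_mobius (z w : C) :
  Cmod (z + Cconj w)%C ^ 2 = Cmod (z - w)%C ^ 2 + 4 * Re z * Re w.
Proof. rewrite !Cmod2_alt. unfold Re, Im; simpl. ring. Qed.

Lemma schwarz_pick_pos (P : C -> C) :
  twice_holomorphic_on Pi P -> (forall z, Pi z -> 0 < Re (P z)) ->
  forall z w, Pi z -> Pi w ->
    Cmod (P z - P w)%C ^ 2 * (Re z * Re w)
      <= Cmod (z - w)%C ^ 2 * (Re (P z) * Re (P w)).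
Proof.
intros HP Hpos z w Hz Hw.
(* cay maps the unit disc onto the half-plane and 0 to w; bla maps the
   half-plane into the unit disc and P w to 0. *)
set (cay := fun u => ((w + Cconj w * u) * / (1 + - (1) * u))%C).
set (bla := fun y => ((y + - P w) * / (y + Cconj (P w)))%C).
set (g := fun u => bla (P (cay u))).
assert (Hden : forall u, Cmod u < 1 -> (1 + - (1) * u)%C <> 0%C).
{ intros u Hu H0. assert (u = 1%C).
  { replace u with (1 - (1 + - (1) * u))%C by ring. rewrite H0. ring. }
  subst u. rewrite Cmod_1 in Hu. lra. }
assert (Hcay : forall u, Cmod u < 1 -> Pi (cay u)).
{ intros u Hu. unfold Pi, cay. specialize (Hden u Hu).
  assert (HC := proj1 (Cmod_gt_0 _) Hden).
  set (D := (1 + - (1) * u)%C) in *.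
  assert (E : (Re ((w + Cconj w * u) * / D)%C * Cmod D ^ 2
     = Re w * (1 - Cmod u ^ 2))).
  { rewrite Re_mult_inv, (Cmod2_alt u) by exact Hden.
    unfold D, Re, Im; simpl. ring. }
  assert (0 < Cmod D ^ 2) by (apply pow_lt; exact HC).
  assert (0 <= Cmod u) by apply Cmod_ge_0.
  unfold Pi in Hw.
  assert (0 < Re w * (1 - Cmod u ^ 2)) by (apply Rmult_lt_0_compat; nra).
  nra. }
assert (Hden2 : forall y, 0 < Re y -> (y + Cconj (P w))%C <> 0%C).
{ intros y Hy H0. assert (Hr : Re (y + Cconj (P w))%C = 0) by (rewrite H0; reflexivity).
  specialize (Hpos w Hw). unfold Re in *. simpl in Hr. lra. }
assert (Hbla : forall y, 0 < Re y -> Cmod (bla y) <= 1).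
{ intros y Hy. unfold bla. specialize (Hden2 y Hy).
  rewrite Cmod_mult, Cmod_inv by exact Hden2.
  assert (HC := proj1 (Cmod_gt_0 _) Hden2).
  assert (HH := half_plane_mobius y (P w)).
  assert (0 < Re y * Re (P w)) by (apply Rmult_lt_0_compat; [exact Hy | apply Hpos; exact Hw]).
  apply Rmult_le_reg_r with (Cmod (y + Cconj (P w))%C); [exact HC |].
  rewrite Rmult_assoc, Rinv_l by lra.
  change (y + - P w)%C with (y - P w)%C.
  assert (0 <= Cmod (y - P w)%C) by apply Cmod_ge_0. nra. }
assert (Hcay0 : cay 0%C = w) by (unfold cay; field; intros H; inversion H; lra).
assert (Hgs : forall u, Cmod u < 1 -> Cmod (g u) <= Cmod u).
{ apply schwarz_lemma.
  - apply (twice_holomorphic_comp _ (fun y => 0 < Re y) bla (fun u => P (cay u))).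
    + apply twice_holomorphic_mult; [| apply twice_holomorphic_inv].
      * apply twice_holomorphic_plus;
          [apply twice_holomorphic_id | apply twice_holomorphic_const].
      * apply twice_holomorphic_plus;
          [apply twice_holomorphic_id | apply twice_holomorphic_const].
      * exact Hden2.
    + apply (twice_holomorphic_comp _ Pi P cay); [exact HP | | exact Hcay].
      apply twice_holomorphic_mult; [| apply twice_holomorphic_inv].
      * apply twice_holomorphic_plus; [apply twice_holomorphic_const |].
        apply twice_holomorphic_mult;
          [apply twice_holomorphic_const | apply twice_holomorphic_id].
      * apply twice_holomorphic_plus; [apply twice_holomorphic_const |].
        apply twice_holomorphic_mult;
          [apply twice_holomorphic_const | apply twice_holomorphic_id].
      * exact Hden.
    + intros u Hu. apply Hpos, Hcay, Hu.
  - unfold g. rewrite Hcay0. unfold bla. ring.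
  - intros u Hu. apply Hbla, Hpos, Hcay, Hu. }
unfold Pi in *.
assert (Hzw : (z + Cconj w)%C <> 0%C).
{ intros H0. assert (Hr : Re (z + Cconj w)%C = 0) by (rewrite H0; reflexivity).
  unfold Re in *. simpl in Hr. lra. }
assert (Hzwm := proj1 (Cmod_gt_0 _) Hzw).
set (u := ((z - w) * / (z + Cconj w))%C).
assert (Hww : (w + Cconj w)%C <> 0%C).
{ intros H0. assert (Hr : Re (w + Cconj w)%C = 0) by (rewrite H0; reflexivity).
  unfold Re in *. simpl in Hr. lra. }
assert (Hcu : cay u = z).
{ unfold cay, u. field. split; [exact Hzw |].
  intros H0. apply Hww. rewrite <- H0. ring. }
assert (Hum : Cmod u = Cmod (z - w)%C / Cmod (z + Cconj w)%C).
{ unfold u. rewrite Cmod_mult, Cmod_inv by exact Hzw. reflexivity. }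
assert (Hpz := Hpos z Hz). assert (Hpw := Hpos w Hw).
assert (HY := half_plane_mobius z w).
assert (HX := half_plane_mobius (P z) (P w)).
assert (Hxm := proj1 (Cmod_gt_0 _) (Hden2 (P z) Hpz)).
assert (Ha := Cmod_ge_0 (z - w)%C). assert (Hb := Cmod_ge_0 (P z - P w)%C).
assert (HzRw : 0 < Re z * Re w) by (apply Rmult_lt_0_compat; assumption).
assert (HzRP : 0 < Re (P z) * Re (P w)) by (apply Rmult_lt_0_compat; assumption).
assert (Hu1 : Cmod u < 1).
{ rewrite Hum. apply Rmult_lt_reg_r with (Cmod (z + Cconj w)%C); [exact Hzwm |].
  unfold Rdiv. rewrite Rmult_assoc, Rinv_l by lra. nra. }
specialize (Hgs u Hu1). unfold g in Hgs. rewrite Hcu, Hum in Hgs.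
unfold bla in Hgs. change (P z + - P w)%C with (P z - P w)%C in Hgs.
rewrite Cmod_mult, Cmod_inv in Hgs by (apply Hden2; exact Hpz).
set (b := Cmod (P z - P w)%C) in *. set (a := Cmod (z - w)%C) in *.
set (x := Cmod (P z + Cconj (P w))%C) in *. set (y := Cmod (z + Cconj w)%C) in *.
assert (Hmul : b * y <= a * x).
{ apply Rmult_le_compat_r with (r := x * y) in Hgs; [| nra].
  replace (b * / x * (x * y)) with (b * y) in Hgs by (field; lra).
  replace (a / y * (x * y)) with (a * x) in Hgs by (field; lra). exact Hgs. }
assert (Hsq : (b * y) ^ 2 <= (a * x) ^ 2) by (apply pow_incr; split; [nra | exact Hmul]).
replace ((b * y) ^ 2) with (b ^ 2 * y ^ 2) in Hsq by ring.
replace ((a * x) ^ 2) with (a ^ 2 * x ^ 2) in Hsq by ring.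
rewrite HX, HY in Hsq. lra.
Qed.

(** Real part zero is allowed, by adding a positive constant to [P]. *)
Lemma schwarz_pick (P : C -> C) :
  twice_holomorphic_on Pi P -> (forall z, Pi z -> 0 <= Re (P z)) ->
  forall z w, Pi z -> Pi w ->
    Cmod (P z - P w)%C ^ 2 * (Re z * Re w)
      <= Cmod (z - w)%C ^ 2 * (Re (P z) * Re (P w)).
Proof.
intros HP Hpos z w Hz Hw.
assert (H : forall e, 0 < e -> Cmod (P z - P w)%C ^ 2 * (Re z * Re w)
      <= Cmod (z - w)%C ^ 2 * ((Re (P z) + e) * (Re (P w) + e))).
{ intros e He.
  assert (HS := schwarz_pick_pos (fun y => P y + RtoC e)%C).
  assert (HR : forall y, Re (P y + RtoC e)%C = Re (P y) + e) by reflexivity.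
  replace (P z - P w)%C with ((P z + RtoC e) - (P w + RtoC e))%C by ring.
  rewrite <- !HR. apply HS; trivial.
  - apply twice_holomorphic_plus; [exact HP | apply twice_holomorphic_const].
  - intros y Hy. rewrite HR. specialize (Hpos y Hy). lra. }
specialize (Hpos z Hz) as Hpz. specialize (Hpos w Hw) as Hpw.
set (a := Cmod (z - w)%C ^ 2) in *.
assert (Ha : 0 <= a) by apply pow2_ge_0.
apply le_epsilon. intros e He.
set (k := a * (Re (P z) + Re (P w) + 1)).
assert (Hk : 0 <= k) by (apply Rmult_le_pos; lra).
assert (Hs : 0 < Rmin 1 (e / (k + 1))).
{ apply Rmin_pos; [lra |]. apply Rdiv_lt_0_compat; lra. }
set (s := Rmin 1 (e / (k + 1))) in *.
assert (s1 : s <= 1) by apply Rmin_l.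
assert (s2 : s * (k + 1) <= e).
{ apply Rle_trans with (e / (k + 1) * (k + 1)).
  - apply Rmult_le_compat_r; [lra | apply Rmin_r].
  - right. field. lra. }
eapply Rle_trans; [apply (H s Hs) |].
assert (a * ((Re (P z) + s) * (Re (P w) + s))
   <= a * (Re (P z) * Re (P w)) + k * s).
{ unfold k.
  replace (a * (Re (P z) * Re (P w)) + a * (Re (P z) + Re (P w) + 1) * s)
    with (a * (Re (P z) * Re (P w) + (Re (P z) + Re (P w) + 1) * s)) by ring.
  apply Rmult_le_compat_l; [exact Ha | nra]. }
nra.
Qed.

(** * Univalent maps and their inverses *)

Lemma ex_derive_minus_const (h : C -> C) (z a : C) :
  ex_derive h z -> ex_derive (fun w => h w - a)%C z.
Proof.
intros [l Hl]. exists (minus l (RtoC 0)).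
exact (is_derive_minus (V := C_NormedModule) h (fun _ => a) z l _ Hl
  (is_derive_C_const a z)).
Qed.

Lemma ex_derive_C_id (z : C) : ex_derive (fun w : C => w) z.
Proof. exists (RtoC 1). apply is_derive_C_id. Qed.

Lemma continuous_dist (h : C -> C) (z a : C) :
  ex_derive h z ->
  continuous (T := C_UniformSpace) (fun w => Cmod (h w - a)%C) z.
Proof.
intros Hh. apply (continuous_Cmod_derive (fun w => (h w - a)%C)).
apply ex_derive_minus_const. exact Hh.
Qed.

Lemma closed_disc (a : C) (r : R) :
  closed (T := C_UniformSpace) (fun z => Cmod (z - a)%C <= r).
Proof.
apply (closed_comp (U := R_UniformSpace) (fun z => Cmod (z - a)%C)
         (fun x => x <= r)); [| apply closed_le].
intros z. apply (continuous_dist (fun w => w)). apply ex_derive_C_id.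
Qed.

Lemma closed_circle (a : C) (r : R) :
  closed (T := C_UniformSpace) (fun z => Cmod (z - a)%C = r).
Proof.
apply (closed_comp (U := R_UniformSpace) (fun z => Cmod (z - a)%C)
         (fun x => x = r)); [| apply closed_eq].
intros z. apply (continuous_dist (fun w => w)). apply ex_derive_C_id.
Qed.

(** Moving from [m] in the direction [- (h m - w) / l] brings [h] closer to
    [w] at first order. *)
Lemma dist_no_local_min (h : C -> C) (m l w : C) :
  is_derive h m l -> l <> 0%C -> h m <> w ->
  ~ locally m (fun z => Cmod (h m - w)%C <= Cmod (h z - w)%C).
Proof.
intros Hh Hl Hw Hmin. set (y := (h m - w)%C) in *.
assert (Hy : 0 < Cmod y).
{ apply Cmod_gt_0. intros H0. apply Hw.
  replace (h m) with (y + w)%C by (unfold y; ring). rewrite H0. ring. }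
set (e := (- y * / l)%C). assert (He := Cmod_ge_0 e).
set (eps := Cmod y / (2 * (Cmod e + 1))).
assert (Heps : 0 < eps) by (apply Rdiv_lt_0_compat; lra).
destruct (proj1 (is_derive_C_eps _ _ _) Hh eps Heps) as [d1 [Hd1 H1]].
apply locally_C_Cmod in Hmin. destruct Hmin as [d2 [Hd2 H2]].
set (d := Rmin d1 d2). assert (Hd : 0 < d) by (apply Rmin_pos; assumption).
set (s := Rmin (1 / 2) (d / (2 * (Cmod e + 1)))).
assert (Hs : 0 < s) by (apply Rmin_pos; [lra | apply Rdiv_lt_0_compat; lra]).
assert (s1 : s <= 1 / 2) by apply Rmin_l.
assert (s2 : s * (Cmod e + 1) <= d / 2).
{ apply Rle_trans with (d / (2 * (Cmod e + 1)) * (Cmod e + 1)).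
  - apply Rmult_le_compat_r; [lra | apply Rmin_r].
  - right. field. lra. }
set (z := (m + s * e)%C).
assert (Hz : (z - m = s * e)%C) by (unfold z; ring).
assert (Hzm : Cmod (z - m)%C = s * Cmod e).
{ rewrite Hz, Cmod_mult, Cmod_R, Rabs_pos_eq by lra. reflexivity. }
assert (Hzd : Cmod (z - m)%C < d) by (rewrite Hzm; nra).
specialize (H1 z (Rlt_le_trans _ _ _ Hzd (Rmin_l _ _))).
specialize (H2 z (Rlt_le_trans _ _ _ Hzd (Rmin_r _ _))).
assert (E : (h z - w = (h z - h m - l * (z - m)) + RtoC (1 - s) * y)%C).
{ rewrite Hz. unfold e, y. rewrite RtoC_minus. field. exact Hl. }
rewrite E in H2.
assert (T := Cmod_triangle (h z - h m - l * (z - m))%C (RtoC (1 - s) * y)%C).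
rewrite Cmod_mult, Cmod_R, Rabs_pos_eq in T by lra.
rewrite Hzm in H1.
assert (eps * (s * Cmod e) <= s * (Cmod y / 2)).
{ replace (Cmod y / 2) with (eps * (Cmod e + 1)) by (unfold eps; field; lra).
  assert (0 <= eps * s) by nra. nra. }
nra.
Qed.

(** Injectivity keeps [h] away from [h z0] on a small circle around [z0]. For [w]
    close to [h z0] the distance to [w] thus has its minimum over the disc inside,
    where it has to vanish. Because the preimage is found near [z0], this
    also yields continuity of the inverse. *)
Lemma univalent_open (D : C -> Prop) (h : C -> C) (z0 : C) (r : R) :
  (forall z, D z -> locally z D) -> injective_on D h ->
  (forall z, D z -> exists l : C, l <> 0%C /\ is_derive h z l) ->
  D z0 -> 0 < r ->
  exists rho, 0 < rho /\ forall w, Cmod (w - h z0)%C < rho ->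
    exists z, D z /\ Cmod (z - z0)%C < r /\ h z = w.
Proof.
intros HD Hinj Hh Hz0 Hr.
destruct (proj1 (locally_C_Cmod _ _) (HD z0 Hz0)) as [d [Hd HdD]].
set (k := Rmin (r / 2) (d / 2)).
assert (Hk : 0 < k) by (apply Rmin_pos; lra).
assert (k1 : k <= r / 2) by apply Rmin_l.
assert (k2 : k <= d / 2) by apply Rmin_r.
assert (HkD : forall z, Cmod (z - z0)%C <= k -> D z).
{ intros z Hz. apply HdD. lra. }
assert (Hbd : forall z, Cmod (z - z0)%C <= k -> Cmod z <= Cmod z0 + k).
{ intros z Hz. assert (T := Cmod_triangle_rev z z0). lra. }
assert (Hdist : forall w z, Cmod (z - z0)%C <= k ->
  continuous (T := C_UniformSpace) (fun u => - Cmod (h u - w)%C) z).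
{ intros w z Hz.
  apply (continuous_opp (V := R_NormedModule) (fun u => Cmod (h u - w)%C)).
  apply continuous_dist.
  destruct (Hh z (HkD z Hz)) as [l [_ Hl]]. exists l. exact Hl. }
destruct (extreme_value (fun z => Cmod (z - z0)%C = k)
            (fun z => - Cmod (h z - h z0)%C) (Cmod z0 + k)) as [m [Hm Hmin]].
- intros z Hz. apply Hbd. lra.
- apply closed_circle.
- intros z Hz. apply Hdist. lra.
- exists (z0 + k)%C. replace (z0 + k - z0)%C with (RtoC k) by ring.
  rewrite Cmod_R. apply Rabs_pos_eq. lra.
- set (mu := Cmod (h m - h z0)%C) in *.
  assert (Hmu : 0 < mu).
  { apply Cmod_gt_0. intros H0.
    assert (E : h m = h z0).
    { replace (h m) with (h m - h z0 + h z0)%C by ring. rewrite H0. ring. }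
    apply Hinj in E; [| apply HkD; lra | exact Hz0].
    subst m. replace (z0 - z0)%C with (RtoC 0) in Hm by ring.
    rewrite Cmod_0 in Hm. lra. }
  exists (mu / 2). split; [lra |]. intros w Hw.
  destruct (extreme_value (fun z => Cmod (z - z0)%C <= k)
            (fun z => - Cmod (h z - w)%C) (Cmod z0 + k)) as [p [Hp Hpmin]].
  + exact Hbd.
  + apply closed_disc.
  + intros z Hz. apply Hdist. exact Hz.
  + exists z0. replace (z0 - z0)%C with (RtoC 0) by ring.
    rewrite Cmod_0. lra.
  + assert (Hpz : Cmod (h p - w)%C <= Cmod (h z0 - w)%C).
    { assert (H0 : - Cmod (h z0 - w)%C <= - Cmod (h p - w)%C).
      { apply Hpmin. replace (z0 - z0)%C with (RtoC 0) by ring.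
        rewrite Cmod_0. lra. }
      lra. }
    rewrite (Cmod_minus_sym (h z0) w) in Hpz.
    assert (Hpk : Cmod (p - z0)%C < k).
    { destruct Hp as [Hp | Hp]; [exact Hp |]. exfalso.
      specialize (Hmin p Hp).
      assert (T := Cmod_triangle (h p - w)%C (w - h z0)%C).
      replace (h p - w + (w - h z0))%C with (h p - h z0)%C in T by ring. lra. }
    exists p. split; [apply HkD; lra |]. split; [lra |].
    apply NNPP. intros Hne.
    destruct (Hh p (HkD p (Rlt_le _ _ Hpk))) as [l [Hl0 Hl]].
    apply (dist_no_local_min h p l w Hl Hl0 Hne).
    apply locally_C_Cmod. exists (k - Cmod (p - z0)%C). split; [lra |].
    intros z Hz.
    assert (T := Cmod_triangle (z - p)%C (p - z0)%C).
    replace (z - p + (p - z0))%C with (z - z0)%C in T by ring.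
    assert (H0 : - Cmod (h z - w)%C <= - Cmod (h p - w)%C)
      by (apply Hpmin; lra).
    lra.
Qed.

Lemma image_open (D : C -> Prop) (h : C -> C) (w : C) :
  (forall z, D z -> locally z D) -> injective_on D h ->
  (forall z, D z -> exists l : C, l <> 0%C /\ is_derive h z l) ->
  image D h w -> locally w (image D h).
Proof.
intros HD Hinj Hh [z [Hz <-]].
destruct (univalent_open D h z 1 HD Hinj Hh Hz) as [r [Hr H]]; [lra |].
apply locally_C_Cmod. exists r. split; [exact Hr |].
intros w Hw. destruct (H w Hw) as [z' [Hz' [_ E]]]. exists z'. auto.
Qed.

Lemma is_derive_inv_on (D : C -> Prop) (h : C -> C) (w l : C) :
  (forall z, D z -> locally z D) -> injective_on D h ->
  (forall z, D z -> exists l : C, l <> 0%C /\ is_derive h z l) ->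
  image D h w -> is_derive h (inv_on D h w) l -> l <> 0%C ->
  is_derive (inv_on D h) w (/ l)%C.
Proof.
intros HD Hinj Hh Hw Hl Hl0.
destruct (inv_on_image D h w Hw) as [Hz Hhz].
set (z := inv_on D h w) in *.
assert (HL := proj1 (Cmod_gt_0 l) Hl0). set (L := Cmod l) in *.
apply is_derive_C_eps. intros eps Heps.
set (e := Rmin (L / 2) (eps * L ^ 2 / 2)).
assert (HL2 : 0 < L ^ 2) by (apply pow_lt; exact HL).
assert (He : 0 < e) by (apply Rmin_pos; nra).
assert (e1 : e <= L / 2) by apply Rmin_l.
assert (e2 : e <= eps * L ^ 2 / 2) by apply Rmin_r.
destruct (proj1 (is_derive_C_eps _ _ _) Hl e He) as [r [Hr H1]].
destruct (univalent_open D h z r HD Hinj Hh Hz Hr) as [rho [Hrho H2]].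
exists rho. split; [exact Hrho |]. intros w' Hw'.
rewrite Hhz in H2. destruct (H2 w' Hw') as [z' [Hz' [Hzr E]]].
assert (Ez : inv_on D h w' = z') by (rewrite <- E; apply inv_on_left; assumption).
rewrite Ez. fold z. specialize (H1 z' Hzr).
rewrite E, Hhz in H1.
set (x := Cmod (z' - z)%C) in *. assert (Hx : 0 <= x) by apply Cmod_ge_0.
assert (Hxw : L / 2 * x <= Cmod (w' - w)%C).
{ assert (T := Cmod_triangle_rev (l * (z' - z))%C (w' - w)%C).
  rewrite (Cmod_minus_sym (l * (z' - z))%C) in T.
  rewrite Cmod_mult in T. fold L x in T. nra. }
replace (z' - z - / l * (w' - w))%C
  with (- / l * (w' - w - l * (z' - z)))%C by (field; exact Hl0).
rewrite Cmod_mult, Cmod_opp, Cmod_inv by exact Hl0. fold L.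
apply Rmult_le_reg_l with L; [exact HL |].
rewrite <- Rmult_assoc, Rinv_r, Rmult_1_l by lra.
apply Rle_trans with (e * x); [exact H1 |].
apply Rle_trans with (eps * L ^ 2 / 2 * x); [apply Rmult_le_compat_r; lra |].
replace (eps * L ^ 2 / 2 * x) with (L * (eps * (L / 2 * x))) by field.
apply Rmult_le_compat_l; [lra |]. apply Rmult_le_compat_l; lra.
Qed.

Lemma locally_Pi (z : C) : Pi z -> locally z Pi.
Proof.
intros Hz. apply locally_C_Cmod. exists (Re z). split; [exact Hz |].
intros w Hw. unfold Pi.
assert (H := Rle_lt_trans _ _ _ (re_le_Cmod (w - z)%C) Hw).
apply Rabs_lt_between in H. unfold Re in *. simpl in H. lra.
Qed.

Lemma Cinv_neq_0 (z : C) : z <> 0%C -> (/ z)%C <> 0%C.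
Proof.
intros Hz E. apply C1_nz. rewrite <- (Cinv_r z Hz), E. ring.
Qed.

(** A univalent primitive of [1 / f]: in the coordinate [h] the field [f] is
    the constant field 1. *)
Definition koenigs_of (h f : C -> C) : Prop :=
  injective_on Pi h /\
  forall z, Pi z -> f z <> 0%C /\ ex_derive f z /\ is_derive h z (/ f z)%C.

Lemma koenigs_of_derive_neq0 (h f : C -> C) :
  koenigs_of h f ->
  forall z, Pi z -> exists l : C, l <> 0%C /\ is_derive h z l.
Proof.
intros [_ H] z Hz. destruct (H z Hz) as [H0 [_ H1]].
exists (/ f z)%C. split; [apply Cinv_neq_0; exact H0 | exact H1].
Qed.

Lemma koenigs_image_open (h f : C -> C) (w : C) :
  koenigs_of h f -> image Pi h w -> locally w (image Pi h).
Proof.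
intros H. apply image_open; [exact locally_Pi | apply H |].
exact (koenigs_of_derive_neq0 h f H).
Qed.

Lemma koenigs_inv_derive (h f : C -> C) (w : C) :
  koenigs_of h f -> image Pi h w ->
  is_derive (inv_on Pi h) w (f (inv_on Pi h w)).
Proof.
intros H Hw. destruct (inv_on_image _ _ _ Hw) as [Hz _].
destruct (proj2 H _ Hz) as [H0 [_ H1]].
replace (f (inv_on Pi h w)) with (/ / f (inv_on Pi h w))%C
  by (field; exact H0).
apply is_derive_inv_on; trivial.
- exact locally_Pi.
- apply H.
- exact (koenigs_of_derive_neq0 h f H).
- apply Cinv_neq_0. exact H0.
Qed.

(** The trajectory from [z] of the field [f * e] when [h] is a primitive
    of [1 / f]; it is meaningful as long as [h z + t e] lies in the image
    of [h]. *)
Definition orbit (h : C -> C) (e z : C) (t : R) : C :=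
  inv_on Pi h (h z + RtoC t * e)%C.

Lemma orbit_derive (h f : C -> C) (e z : C) (t : R) :
  koenigs_of h f -> image Pi h (h z + RtoC t * e)%C ->
  curve_derive (orbit h e z) t (f (orbit h e z t) * e)%C.
Proof.
intros H Hw.
apply (curve_derive_comp (inv_on Pi h) (fun s => (h z + RtoC s * e)%C)).
- exact (koenigs_inv_derive h f _ H Hw).
- apply curve_derive_line.
Qed.

(** The derivative in [z] is [f (orbit h e z t) / f z], which is differentiable
    again since [f] is. *)
Lemma orbit_twice_holomorphic (h f : C -> C) (e : C) (t : R) :
  koenigs_of h f ->
  (forall z, Pi z -> image Pi h (h z + RtoC t * e)%C) ->
  twice_holomorphic_on Pi (fun z => orbit h e z t).
Proof.
intros H Him.
exists (fun z => f (orbit h e z t) * / f z)%C.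
assert (Hd : forall z, Pi z ->
  is_derive (fun z => orbit h e z t) z (f (orbit h e z t) * / f z)%C).
{ intros z Hz.
  apply (is_derive_C_comp (inv_on Pi h) (fun w => h w + t * e)%C).
  - exact (koenigs_inv_derive h f _ H (Him z Hz)).
  - replace (/ f z)%C with (/ f z + 0)%C by ring.
    apply (is_derive_plus (V := C_NormedModule)).
    + apply H. exact Hz.
    + apply is_derive_C_const. }
intros z Hz. split; [exact (Hd z Hz) |].
destruct (inv_on_image _ _ _ (Him z Hz)) as [Ho _].
destruct (proj2 H _ Hz) as [H0 [[f1 Hf1] _]].
destruct (proj2 H _ Ho) as [_ [[f2 Hf2] _]].
eexists. apply is_derive_Cmult.
- apply (is_derive_C_comp f (fun w => orbit h e w t)); [exact Hf2 |].
  exact (Hd z Hz).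
- apply is_derive_Cinv; [exact Hf1 | exact H0].
Qed.

(** * Wolff's lemma and the sign of the generator *)

Lemma at_right_pos (P : R -> Prop) :
  at_right 0 P -> forall d, 0 < d -> exists t, 0 < t < d /\ P t.
Proof.
intros HP d Hd.
assert (H : at_right 0 (fun t => 0 < t < d)).
{ exists (mkposreal d Hd). intros t Ht Ht0. change (Rabs (t - 0) < d) in Ht.
  rewrite Rminus_0_r, Rabs_pos_eq in Ht by lra. lra. }
destruct (filter_ex _ (filter_and _ _ H HP)) as [t [H1 H2]].
exists t. auto.
Qed.

(** Dividing [h (F_t z) - h z = t] by [t] and letting [t] tend to 0 gives
    [h' z * f z = 1]. *)
Lemma koenigs_of_generator (F : R -> C -> C) (f h : C -> C) :
  continuous_semigroup F -> is_generator F f -> is_koenigs F h ->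
  koenigs_of h f.
Proof.
intros [HF [_ Hc]] [[Hf _] Hgen] [[Hh Hinj] [Hkoe _]]. split; [exact Hinj |].
intros z Hz.
assert (Hex : exists l : C, is_derive h z l) by exact (Hh z Hz).
destruct Hex as [l Hl].
assert (E : (l * f z)%C = 1%C).
{ assert (Hn : Cmod (1 - l * f z)%C <= 0).
  { apply le_epsilon. intros eps Heps.
    set (A := Cmod (f z) + Cmod l + 1).
    assert (P1 := Cmod_ge_0 (f z)). assert (P2 := Cmod_ge_0 l).
    assert (HA : 0 < A) by (unfold A; lra).
    set (e := Rmin 1 (eps / A)).
    assert (He : 0 < e) by (apply Rmin_pos; [lra | apply Rdiv_lt_0_compat; lra]).
    assert (e1 : e <= 1) by apply Rmin_l.
    assert (e2 : e * A <= eps).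
    { apply Rle_trans with (eps / A * A).
      - apply Rmult_le_compat_r; [lra | apply Rmin_r].
      - right. field. lra. }
    destruct (proj1 (is_derive_C_eps _ _ _) Hl e He) as [d [Hd H1]].
    assert (N1 : at_right 0 (fun t => Cmod (F t z - z)%C < d)).
    { apply (Hc z Hz (fun w => Cmod (w - z)%C < d)). apply locally_C_Cmod. exists d. auto. }
    assert (N2 : at_right 0 (fun t : R => Cmod ((F t z - z) / t - f z)%C < e)).
    { apply (Hgen z Hz (fun w => Cmod (w - f z)%C < e)).
      apply locally_C_Cmod. exists e. auto. }
    destruct (at_right_pos _ (filter_and _ _ N1 N2) 1) as [t [Ht [K1 K2]]]; [lra |].
    specialize (H1 _ K1). rewrite Hkoe in H1 by (trivial; lra).
    set (q := ((F t z - z) / t)%C) in *.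
    assert (Ht0 : RtoC t <> 0%C) by (intros H; apply RtoC_inj in H; lra).
    assert (Eq : (F t z - z)%C = (t * q)%C) by (unfold q; field; exact Ht0).
    rewrite Eq in H1.
    replace (h z + t - h z - l * (t * q))%C with (t * (1 - l * q))%C in H1 by ring.
    rewrite !Cmod_mult, Cmod_R, Rabs_pos_eq in H1 by lra.
    assert (K3 : Cmod (1 - l * q)%C <= e * Cmod q).
    { apply Rmult_le_reg_l with t; lra. }
    assert (K4 := Cmod_triangle_rev q (f z)).
    replace (1 - l * f z)%C with (1 - l * q + l * (q - f z))%C by ring.
    assert (T := Cmod_triangle (1 - l * q)%C (l * (q - f z))%C).
    rewrite Cmod_mult in T.
    assert (e * Cmod q <= e * (Cmod (f z) + 1)) by (apply Rmult_le_compat_l; lra).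
    assert (Cmod l * Cmod (q - f z)%C <= Cmod l * e)
      by (apply Rmult_le_compat_l; lra).
    unfold A in e2. lra. }
  assert (H0 : (1 - l * f z)%C = 0%C).
  { apply Cmod_eq_0. apply Rle_antisym; [exact Hn | apply Cmod_ge_0]. }
  replace (l * f z)%C with (1 - (1 - l * f z))%C by ring. rewrite H0. ring. }
assert (Hfz : f z <> 0%C).
{ intros H0. apply C1_nz. rewrite <- E, H0. ring. }
split; [exact Hfz |]. split; [apply Hf; exact Hz |].
replace (/ f z)%C with l; [exact Hl |].
replace l with (l * f z * / f z)%C by (field; exact Hfz).
rewrite E. field. exact Hfz.
Qed.

Lemma tends_to_infinity_iff (g : R -> C) :
  tends_to_infinity g <->
  forall M, exists N, forall t, N < t -> M < Cmod (g t).
Proof.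
split.
- intros H M. destruct (H (fun x => M < x)) as [N HN]; [exists M; auto |].
  exists N. exact HN.
- intros H P [M HM]. destruct (H M) as [N HN]. exists N. intros t Ht.
  apply HM, HN, Ht.
Qed.

(** Apply Schwarz-Pick to [z] and [w n]. The numbers [|w n|^2 / Re (w n)] are
    at least [|w n|], hence unbounded, so that infinitely often they do not
    decrease. For such [n] the inequality becomes, up to factors
    tending to 1, [Re z <= Re (P z)]. *)
Lemma wolff_lemma (P : C -> C) (w : nat -> C) :
  twice_holomorphic_on Pi P -> (forall z, Pi z -> Pi (P z)) ->
  (forall n, Pi (w n)) -> (forall n, P (w n) = w (S n)) ->
  (forall M, exists N, forall n, (N <= n)%nat -> M < Cmod (w n)) ->
  forall z, Pi z -> Re z <= Re (P z).
Proof.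
intros HP HPi Hw HPw Hinf z Hz. apply Rnot_lt_le. intros Hlt.
assert (HB := HPi z Hz). unfold Pi in *.
set (A := Re z) in *. set (B := Re (P z)) in *.
(* k bounds both |P z| / |w (n+1)| and |z| / |w n|; its value makes the final
   (1 - k)^2 A <= (1 + k)^2 B contradict B < A. *)
set (k := (A - B) / (10 * A)).
assert (Hk : 0 < k) by (apply Rdiv_lt_0_compat; lra).
assert (HkA : k * (10 * A) = A - B) by (unfold k; field; lra).
assert (Hk1 : k < 1) by nra.
assert (Hpz := Cmod_ge_0 (P z)). assert (Hcz := Cmod_ge_0 z).
set (p := Cmod (P z)) in *. set (c := Cmod z) in *.
set (M := (p + c + 1) / k).
assert (HM : 0 < M) by (apply Rdiv_lt_0_compat; lra).
assert (HMk : k * M = p + c + 1) by (unfold M; field; lra).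
destruct (Hinf M) as [N HN].
set (a := fun n => Cmod (w n) ^ 2 / Re (w n)).
assert (Ha : forall n, Cmod (w n) <= a n).
{ intros n. unfold a. specialize (Hw n).
  apply Rmult_le_reg_r with (Re (w n)); [exact Hw |].
  unfold Rdiv. rewrite Rmult_assoc, Rinv_l by lra.
  assert (H1 := re_le_Cmod (w n)). rewrite Rabs_pos_eq in H1 by lra.
  assert (H2 := Cmod_ge_0 (w n)). nra. }
assert (Hex : exists n, (N <= n)%nat /\ a n <= a (S n)).
{ apply NNPP. intros Hno.
  assert (Hdec : forall j, a (N + j)%nat <= a N).
  { induction j as [| j IH]; [rewrite Nat.add_0_r; lra |].
    rewrite Nat.add_succ_r. apply Rnot_lt_le. intros Hj. apply Hno.
    exists (N + j)%nat. split; [apply Nat.le_add_r | lra]. }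
  destruct (Hinf (a N)) as [N' HN'].
  specialize (HN' (N + N')%nat). specialize (Hdec N').
  specialize (Ha (N + N')%nat).
  assert (N' <= N + N')%nat by (rewrite Nat.add_comm; apply Nat.le_add_r).
  specialize (HN' H). lra. }
destruct Hex as [n [Hn Han]].
assert (Hx := HN n Hn). assert (Hy := HN (S n) (Nat.le_trans _ _ _ Hn (Nat.le_succ_diag_r n))).
assert (SP := schwarz_pick P HP (fun y Hy => Rlt_le _ _ (HPi y Hy)) z (w n) Hz (Hw n)).
rewrite HPw in SP. fold A B in SP.
assert (T1 := Cmod_triangle_rev (w (S n)) (P z)).
rewrite (Cmod_minus_sym (w (S n))) in T1. fold p in T1.
assert (T2 := Cmod_triangle z (- w n)%C). rewrite Cmod_opp in T2.
change (z + - w n)%C with (z - w n)%C in T2. fold c in T2.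
unfold a in Han.
set (x := Cmod (w n)) in *. set (y := Cmod (w (S n))) in *.
assert (Hr := Hw n). assert (Hr' := Hw (S n)).
set (r := Re (w n)) in *. set (r' := Re (w (S n))) in *.
set (d1 := Cmod (P z - w (S n))%C) in *. set (d2 := Cmod (z - w n)%C) in *.
assert (Hd2 : 0 <= d2) by apply Cmod_ge_0.
assert (Hrr : r' * x ^ 2 <= y ^ 2 * r).
{ apply Rmult_le_compat_r with (r := r * r') in Han; [| nra].
  replace (x ^ 2 / r * (r * r')) with (r' * x ^ 2) in Han by (field; lra).
  replace (y ^ 2 / r' * (r * r')) with (y ^ 2 * r) in Han by (field; lra).
  exact Han. }
assert (Hpk : p <= k * y) by nra. assert (Hck : c <= k * x) by nra.
assert (D1 : (1 - k) * y <= d1) by lra.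
assert (D2 : d2 <= (1 + k) * x) by lra.
assert (D1' : ((1 - k) * y) ^ 2 <= d1 ^ 2) by (apply pow_incr; split; [nra | lra]).
assert (D2' : d2 ^ 2 <= ((1 + k) * x) ^ 2) by (apply pow_incr; lra).
assert (HAr : 0 < A * r) by nra. assert (HBr : 0 < B * r') by nra.
assert (Q1 : ((1 - k) * y) ^ 2 * (A * r) <= ((1 + k) * x) ^ 2 * (B * r')).
{ apply Rle_trans with (d1 ^ 2 * (A * r)); [apply Rmult_le_compat_r; lra |].
  eapply Rle_trans; [exact SP |]. apply Rmult_le_compat_r; lra. }
assert (Q2 : ((1 + k) * x) ^ 2 * (B * r') <= (1 + k) ^ 2 * B * (y ^ 2 * r)).
{ replace (((1 + k) * x) ^ 2 * (B * r')) with ((1 + k) ^ 2 * B * (r' * x ^ 2)) by ring.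
  apply Rmult_le_compat_l; [| exact Hrr].
  apply Rmult_le_pos; [apply pow2_ge_0 | lra]. }
assert (Hyr : 0 < y ^ 2 * r) by (apply Rmult_lt_0_compat; [apply pow_lt |]; lra).
assert (Q3 : (1 - k) ^ 2 * A <= (1 + k) ^ 2 * B).
{ apply Rmult_le_reg_r with (y ^ 2 * r); [exact Hyr |].
  replace ((1 - k) ^ 2 * A * (y ^ 2 * r)) with (((1 - k) * y) ^ 2 * (A * r)) by ring.
  lra. }
assert (k * B <= k * A) by (apply Rmult_le_compat_l; lra).
assert (k ^ 2 * B <= k * B).
{ apply Rmult_le_compat_r; [lra |]. nra. }
assert (0 <= k ^ 2 * A) by (apply Rmult_le_pos; [apply pow2_ge_0 | lra]).
nra.
Qed.

Lemma orbit_spec (h : C -> C) (e z : C) (t : R) :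
  image Pi h (h z + RtoC t * e)%C ->
  Pi (orbit h e z t) /\ h (orbit h e z t) = (h z + RtoC t * e)%C.
Proof. apply inv_on_image. Qed.

Lemma orbit_0 (h : C -> C) (e z : C) :
  injective_on Pi h -> Pi z -> orbit h e z 0 = z.
Proof.
intros Hinj Hz. unfold orbit.
replace (h z + 0 * e)%C with (h z) by ring. apply inv_on_left; assumption.
Qed.

Lemma orbit_orbit (h : C -> C) (e z : C) (s t : R) :
  image Pi h (h z + RtoC s * e)%C ->
  orbit h e (orbit h e z s) t = orbit h e z (s + t).
Proof.
intros H. unfold orbit at 1. rewrite (proj2 (orbit_spec h e z s H)).
unfold orbit. f_equal. rewrite RtoC_plus. ring.
Qed.

Lemma derive_right_quotient (u : R -> R) (l : R) :
  is_derive u 0 l ->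
  filterlim (fun t => (u t - u 0) / t) (at_right 0) (locally l).
Proof.
intros Hu P [eps HP]. assert (Heps := cond_pos eps).
destruct (proj1 (is_derive_R_eps _ _ _) Hu (eps / 2)) as [d [Hd H]]; [lra |].
exists (mkposreal d Hd). intros t Ht Ht0.
change (Rabs (t - 0) < d) in Ht. specialize (H t Ht).
rewrite Rminus_0_r in H. apply HP.
change (Rabs ((u t - u 0) / t - l) < eps).
replace ((u t - u 0) / t - l) with ((u t - u 0 - l * t) * / t) by (field; lra).
rewrite Rabs_mult, (Rabs_pos_eq (/ t)) by (left; apply Rinv_0_lt_compat; lra).
rewrite (Rabs_pos_eq t) in H by lra.
apply Rle_lt_trans with (eps / 2); [| lra].
apply Rmult_le_reg_r with t; [lra |].
rewrite Rmult_assoc, Rinv_l by lra. lra.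
Qed.

Lemma at_right_lim_le (u v : R -> R) (a b : R) :
  filterlim u (at_right 0) (locally a) -> filterlim v (at_right 0) (locally b) ->
  (forall t, 0 < t -> u t <= v t) -> a <= b.
Proof.
intros Hu Hv H.
apply (filterlim_le (F := at_right 0) u v (Finite a) (Finite b)); trivial.
exists (mkposreal 1 Rlt_0_1). intros t _ Ht. apply H. exact Ht.
Qed.

(** The time-[t] map sends the orbit of 1, sampled at the multiples of [t], to its
    shift, so Wolff's lemma applies to it. Real parts thus do not decrease along
    orbits, and the velocity at time 0 has nonnegative real part. *)
Lemma generator_nonneg (h f : C -> C) (e : C) :
  koenigs_of h f ->
  (forall z, Pi z ->
    (forall t, 0 < t -> image Pi h (h z + RtoC t * e)%C) /\
    tends_to_infinity (orbit h e z)) ->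
  forall z, Pi z -> 0 <= Re (f z * e)%C.
Proof.
intros HK H z Hz.
assert (Hmono : forall t, 0 < t -> Re z <= Re (orbit h e z t)).
{ intros t Ht.
  assert (H1 : Pi 1%C) by (unfold Pi; simpl; lra).
  assert (Hpos : forall n, 0 < INR (S n) * t).
  { intros n. apply Rmult_lt_0_compat; [apply lt_0_INR, Nat.lt_0_succ | exact Ht]. }
  apply (wolff_lemma (fun z => orbit h e z t)
           (fun n => orbit h e 1%C (INR (S n) * t))).
  - apply (orbit_twice_holomorphic h f); [exact HK |]. intros y Hy. apply H; assumption.
  - intros y Hy. apply orbit_spec, H; assumption.
  - intros n. apply orbit_spec, H; [exact H1 | apply Hpos].
  - intros n. rewrite orbit_orbit by (apply H; [exact H1 | apply Hpos]).
    f_equal. rewrite (S_INR (S n)). ring.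
  - intros M.
    destruct (proj1 (tends_to_infinity_iff _) (proj2 (H 1%C H1)) M) as [N HN].
    destruct (nfloor_ex (Rmax 0 (N / t))) as [n [_ Hn]]; [apply Rmax_l |].
    exists n. intros j Hj. apply HN.
    assert (Hm := Rmax_r 0 (N / t)). rewrite S_INR. apply le_INR in Hj.
    apply Rmult_lt_reg_r with (/ t); [apply Rinv_0_lt_compat; exact Ht |].
    rewrite Rmult_assoc, Rinv_r by lra. unfold Rdiv in Hm. lra.
  - exact Hz. }
assert (E0 := orbit_0 h e z (proj1 HK) Hz).
assert (Him : image Pi h (h z + RtoC 0 * e)%C).
{ exists z. split; [exact Hz | ring]. }
destruct (orbit_derive h f e z 0 HK Him) as [Hd _]. rewrite E0 in Hd.
apply (at_right_lim_le (fun _ => 0) _ 0 _ (filterlim_const 0)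
         (derive_right_quotient _ _ Hd)).
intros t Ht. rewrite E0. specialize (Hmono t Ht).
apply Rmult_le_pos; [lra | left; apply Rinv_0_lt_compat; exact Ht].
Qed.

(** * Infinitesimal Schwarz-Pick and bounds on orbits *)

Lemma filterlim_Rplus {T : Type} (G : (T -> Prop) -> Prop) {FG : Filter G}
    (u v : T -> R) (a b : R) :
  filterlim u G (locally a) -> filterlim v G (locally b) ->
  filterlim (fun t => u t + v t) G (locally (a + b)).
Proof.
intros Hu Hv.
exact (filterlim_comp_2 _ _ Rplus Hu Hv (filterlim_plus (V := R_NormedModule) a b)).
Qed.

Lemma filterlim_Rmult {T : Type} (G : (T -> Prop) -> Prop) {FG : Filter G}
    (u v : T -> R) (a b : R) :
  filterlim u G (locally a) -> filterlim v G (locally b) ->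
  filterlim (fun t => u t * v t) G (locally (a * b)).
Proof.
intros Hu Hv.
exact (filterlim_comp_2 _ _ Rmult Hu Hv (filterlim_mult (K := R_AbsRing) a b)).
Qed.

Lemma nonincreasing_of_derive (u : R -> R) (a b : R) :
  a <= b ->
  (forall s, a <= s <= b -> exists l, l <= 0 /\ is_derive u s l) ->
  u b <= u a.
Proof.
intros [Hab | ->] H; [| lra].
destruct (MVT_cor2 u (Derive u) a b Hab) as [c [Hc1 Hc2]].
- intros s Hs. apply is_derive_Reals. apply Derive_correct.
  destruct (H s Hs) as [l [_ Hl]]. exists l. exact Hl.
- destruct (H c) as [l [Hl0 Hl]]; [lra |].
  rewrite (is_derive_unique _ _ _ Hl) in Hc1. nra.
Qed.

Lemma is_derive_C_scal_r (q : C -> C) (z l e : C) :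
  is_derive q z l -> is_derive (fun w => q w * e)%C z (l * e)%C.
Proof.
intros H. replace (l * e)%C with (l * e + q z * 0)%C by ring.
apply is_derive_Cmult; [exact H | apply is_derive_C_const].
Qed.

(** The function [f * e] is the limit of [P t / t], where
    [P t y = (orbit h 1 y t - y) * e] has two derivatives in [y]. Its real part is
    nonnegative because it vanishes at [t = 0] and its derivative in [t] is
    the real part of [f * e] along the orbit. The inequality is homogeneous
    in [P], so the factor [1 / t] can be inserted after applying it. *)
Lemma schwarz_pick_generator (h f : C -> C) (e : C) :
  koenigs_of h f ->
  (forall z t, Pi z -> 0 <= t -> image Pi h (h z + RtoC t * 1)%C) ->
  (forall z, Pi z -> 0 <= Re (f z * e)%C) ->
  forall z w, Pi z -> Pi w ->
    Cmod (f z * e - f w * e)%C ^ 2 * (Re z * Re w)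
      <= Cmod (z - w)%C ^ 2 * (Re (f z * e)%C * Re (f w * e)%C).
Proof.
intros HK Him Hpos z w Hz Hw.
set (P := fun t y => ((orbit h 1 y t + - y) * e)%C).
assert (Hd : forall y t, Pi y -> 0 <= t ->
  curve_derive (fun s => P s y) t (f (orbit h 1 y t) * e)%C).
{ intros y t Hy Ht.
  replace (f (orbit h 1 y t) * e)%C with (((1 + 0) * e) * (f (orbit h 1 y t) * 1))%C
    by ring.
  apply (curve_derive_comp (fun u => (u + - y) * e)%C (orbit h 1 y)).
  - apply is_derive_C_scal_r.
    apply (is_derive_plus (V := C_NormedModule));
      [apply is_derive_C_id | apply is_derive_C_const].
  - apply orbit_derive; [exact HK | apply Him; assumption]. }
assert (HP0 : forall y, Pi y -> P 0 y = 0%C).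
{ intros y Hy. unfold P. rewrite orbit_0; [ring | apply HK | exact Hy]. }
assert (HPpos : forall y t, Pi y -> 0 <= t -> 0 <= Re (P t y)).
{ intros y t Hy Ht.
  assert (H : - Re (P t y) <= - Re (P 0 y)).
  { apply (nonincreasing_of_derive (fun s => - Re (P s y))); [exact Ht |].
    intros s Hs. destruct (Hd y s Hy (proj1 Hs)) as [H1 _].
    exists (- Re (f (orbit h 1 y s) * e)%C). split.
    - assert (Ho : Pi (orbit h 1 y s)) by (apply orbit_spec, Him; [exact Hy | apply Hs]).
      specialize (Hpos _ Ho). lra.
    - apply (is_derive_opp (V := R_NormedModule)). exact H1. }
  rewrite (HP0 y Hy) in H. change (Re 0%C) with 0 in H. lra. }
assert (HSP : forall t, 0 < t ->
  Cmod (P t z - P t w)%C ^ 2 * (Re z * Re w)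
    <= Cmod (z - w)%C ^ 2 * (Re (P t z) * Re (P t w))).
{ intros t Ht. apply (schwarz_pick (P t)); trivial.
  - apply twice_holomorphic_mult; [| apply twice_holomorphic_const].
    apply twice_holomorphic_plus.
    + apply (orbit_twice_holomorphic h f); [exact HK |].
      intros y Hy. apply Him; [exact Hy | lra].
    + exists (fun _ => (- (1))%C). intros y _. split.
      * exact (is_derive_opp _ _ _ (is_derive_C_id y)).
      * exists (RtoC 0). apply is_derive_C_const.
  - intros y Hy. apply HPpos; [exact Hy | lra]. }
assert (HX : forall y, Pi y ->
  filterlim (fun t => Re (P t y) / t) (at_right 0) (locally (Re (f y * e)%C)) /\
  filterlim (fun t => Im (P t y) / t) (at_right 0) (locally (Im (f y * e)%C))).
{ intros y Hy. destruct (Hd y 0 Hy (Rle_refl 0)) as [H1 H2].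
  rewrite orbit_0 in H1, H2 by (trivial; apply HK).
  assert (L1 := derive_right_quotient _ _ H1).
  assert (L2 := derive_right_quotient _ _ H2).
  split; [revert L1 | revert L2]; apply filterlim_ext; intros t;
    rewrite (HP0 y Hy); [change (Re 0%C) with 0 | change (Im 0%C) with 0];
    rewrite Rminus_0_r; reflexivity. }
destruct (HX z Hz) as [Z1 Z2]. destruct (HX w Hw) as [W1 W2].
rewrite Cmod2_alt.
assert (HR : forall a b : C, Re (a - b)%C = Re a + -1 * Re b)
  by (intros a b; unfold Re, Im; simpl; ring).
assert (HI : forall a b : C, Im (a - b)%C = Im a + -1 * Im b)
  by (intros a b; unfold Re, Im; simpl; ring).
rewrite HR, HI.
set (X1 := Re (f z * e)%C) in *. set (Y1 := Im (f z * e)%C) in *.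
set (X2 := Re (f w * e)%C) in *. set (Y2 := Im (f w * e)%C) in *.
replace (((X1 + -1 * X2) ^ 2 + (Y1 + -1 * Y2) ^ 2) * (Re z * Re w)) with
  (((X1 + -1 * X2) * (X1 + -1 * X2) + (Y1 + -1 * Y2) * (Y1 + -1 * Y2))
    * (Re z * Re w)) by ring.
assert (Hsub : forall (u v : R -> R) a b,
  filterlim u (at_right 0) (locally a) -> filterlim v (at_right 0) (locally b) ->
  filterlim (fun t => u t + -1 * v t) (at_right 0) (locally (a + -1 * b))).
{ intros u v a b Hu Hv. apply filterlim_Rplus; [exact _ | exact Hu |].
  apply filterlim_Rmult; [exact _ | apply filterlim_const | exact Hv]. }
refine (at_right_lim_le _ _ _ _
  (filterlim_Rmult _ _ _ _ _
    (filterlim_Rplus _ _ _ _ _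
      (filterlim_Rmult _ _ _ _ _ (Hsub _ _ _ _ Z1 W1) (Hsub _ _ _ _ Z1 W1))
      (filterlim_Rmult _ _ _ _ _ (Hsub _ _ _ _ Z2 W2) (Hsub _ _ _ _ Z2 W2)))
    (filterlim_const _))
  (filterlim_Rmult _ _ _ _ _ (filterlim_const _)
    (filterlim_Rmult _ _ _ _ _ Z1 W1)) _).
intros t Ht. specialize (HSP t Ht).
rewrite (Cmod2_alt (P t z - P t w)%C), HR, HI in HSP.
apply Rmult_le_reg_r with (t ^ 2); [apply pow_lt; exact Ht |].
match goal with |- ?l * t ^ 2 <= ?r * t ^ 2 =>
  replace (l * t ^ 2) with
    (((Re (P t z) + -1 * Re (P t w)) ^ 2 + (Im (P t z) + -1 * Im (P t w)) ^ 2)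
     * (Re z * Re w)) by (field; lra);
  replace (r * t ^ 2) with (Cmod (z - w)%C ^ 2 * (Re (P t z) * Re (P t w)))
    by (field; lra)
end.
exact HSP.
Qed.

(** Take [w = z + s], divide by [s^2] and let [s] tend to 0. *)
Lemma schwarz_pick_infinitesimal (g : C -> C) (z g1 : C) :
  (forall z, Pi z -> 0 <= Re (g z)) ->
  (forall z w, Pi z -> Pi w ->
    Cmod (g z - g w)%C ^ 2 * (Re z * Re w)
      <= Cmod (z - w)%C ^ 2 * (Re (g z) * Re (g w))) ->
  Pi z -> is_derive g z g1 ->
  Re g1 * Re z <= Re (g z).
Proof.
intros Hpos HSP Hz Hg.
set (c := fun s : R => (z + RtoC s * 1)%C).
assert (c0 : c 0 = z) by (unfold c; ring).
set (u := fun s => Re (g (c s))).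
assert (u0 : u 0 = Re (g z)) by (unfold u; rewrite c0; reflexivity).
assert (Hu : is_derive u 0 (Re g1)).
{ replace g1 with (g1 * 1)%C by ring.
  apply (curve_derive_comp g c 0 g1 1%C); [rewrite c0; exact Hg |].
  apply curve_derive_line. }
assert (Hx : forall s, Re (c s) = Re z + s) by (intros s; unfold c, Re; simpl; ring).
assert (Hq := derive_right_quotient u _ Hu).
assert (Huc : filterlim u (at_right 0) (locally (u 0))).
{ apply (filterlim_filter_le_1 (F := locally 0)); [apply filter_le_within |].
  apply (ex_derive_continuous (V := R_NormedModule)). exists (Re g1). exact Hu. }
assert (Hid : filterlim (fun s : R => s) (at_right 0) (locally 0)).
{ apply (filterlim_filter_le_1 (F := locally 0)); [apply filter_le_within |].
  apply filterlim_id. }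
assert (Hsq : (Re g1 * Re g1) * (Re z * (Re z + 0)) <= u 0 * u 0).
{ refine (at_right_lim_le _ _ _ _
    (filterlim_Rmult _ _ _ _ _ (filterlim_Rmult _ _ _ _ _ Hq Hq)
      (filterlim_Rmult _ _ _ _ _ (filterlim_const (Re z))
        (filterlim_Rplus _ _ _ _ _ (filterlim_const (Re z)) Hid)))
    (filterlim_Rmult _ _ _ _ _ (filterlim_const (u 0)) Huc) _).
  intros s Hs.
  assert (Hcs : Pi (c s)) by (unfold Pi in *; rewrite Hx; lra).
  assert (H := HSP z (c s) Hz Hcs).
  rewrite Cmod_minus_sym, (Cmod_minus_sym z) in H.
  replace (c s - z)%C with (RtoC s) in H by (unfold c; ring).
  rewrite Cmod_R, Rabs_pos_eq, Hx in H by lra.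
  assert (H2 : (u s - u 0) ^ 2 <= Cmod (g (c s) - g z)%C ^ 2).
  { rewrite Cmod2_alt.
    replace (Re (g (c s) - g z)%C) with (u s - u 0)
      by (rewrite u0; unfold u, Re; simpl; ring).
    assert (H3 := pow2_ge_0 (Im (g (c s) - g z)%C)). lra. }
  fold (u s) in H. rewrite <- u0 in H. unfold Pi in Hz.
  apply Rmult_le_reg_r with (s ^ 2); [apply pow_lt; exact Hs |].
  replace ((u s - u 0) / s * ((u s - u 0) / s) * (Re z * (Re z + s)) * s ^ 2)
    with ((u s - u 0) ^ 2 * (Re z * (Re z + s))) by (field; lra).
  apply Rle_trans with (Cmod (g (c s) - g z)%C ^ 2 * (Re z * (Re z + s)));
    [apply Rmult_le_compat_r; [nra | exact H2] | lra]. }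
assert (H0 := Hpos z Hz). rewrite <- u0 in *. unfold Pi in Hz.
apply Rnot_lt_le. intros Hlt. nra.
Qed.

Lemma is_derive_sqr_quotient (a b x : R -> R) (t da db dx : R) :
  is_derive a t da -> is_derive b t db -> is_derive x t dx -> x t <> 0 ->
  is_derive (fun s => (a s ^ 2 + b s ^ 2) / x s ^ 2) t
    (2 * ((a t * da + b t * db) * x t - (a t ^ 2 + b t ^ 2) * dx) / x t ^ 3).
Proof.
intros Ha Hb Hx H0. evar_last.
- apply is_derive_div.
  + apply (is_derive_plus (V := R_NormedModule)); apply is_derive_pow;
      [exact Ha | exact Hb].
  + apply is_derive_pow. exact Hx.
  + apply pow_nonzero. exact H0.
- unfold plus; simpl. field. exact H0.
Qed.

(** Along the orbit [ga], with [g = f * e], the derivative of [|g|^2 / Re^2] is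
    [2 |g|^2 (Re g' * Re ga - Re g) / Re^3 <= 0]. Hence [|g| <= K Re ga] with [K]
    fixed; by Gronwall [Re ga] is at most [L] before time [T], and the velocity at
    most [K L]. *)
Lemma orbit_bounded (h f : C -> C) (e z : C) (T : R) :
  koenigs_of h f ->
  (forall y, Pi y -> 0 <= Re (f y * e)%C) ->
  (forall y g1, Pi y -> is_derive (fun w => f w * e)%C y g1 ->
     Re g1 * Re y <= Re (f y * e)%C) ->
  Pi z -> 0 < T ->
  (forall s, 0 <= s < T -> image Pi h (h z + RtoC s * e)%C) ->
  exists M, forall s, 0 <= s < T ->
    Re z <= Re (orbit h e z s) /\ Cmod (orbit h e z s) <= M.
Proof.
intros HK Hpos Hinf Hz HT Him.
set (g := fun y => (f y * e)%C) in *.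
set (ga := orbit h e z).
assert (HPi : forall s, 0 <= s < T -> Pi (ga s)) by (intros s Hs; apply orbit_spec, Him, Hs).
assert (Hga : forall s, 0 <= s < T -> curve_derive ga s (g (ga s)))
  by (intros s Hs; apply (orbit_derive h f e z s HK (Him s Hs))).
assert (ga0 : ga 0 = z) by (apply orbit_0; [apply HK | exact Hz]).
set (x := fun s => Re (ga s)).
assert (Hx : forall s, 0 <= s < T -> is_derive x s (Re (g (ga s)))) by (intros s Hs; apply Hga, Hs).
assert (x0 : x 0 = Re z) by (unfold x; rewrite ga0; reflexivity).
assert (Hxge : forall s, 0 <= s < T -> Re z <= x s).
{ intros s Hs.
  assert (H : - x s <= - x 0).
  { apply (nonincreasing_of_derive (fun t => - x t)); [apply Hs |]. intros t Ht.
    exists (- Re (g (ga t))). split.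
    - assert (H1 := Hpos (ga t)). assert (Pi (ga t)) by (apply HPi; lra).
      specialize (H1 H). unfold g. lra.
    - apply (is_derive_opp (V := R_NormedModule)). apply Hx. lra. }
  lra. }
unfold Pi in Hz.
set (K := Cmod (g z) / Re z).
assert (HK0 : 0 <= K) by (apply Rdiv_le_0_compat; [apply Cmod_ge_0 | exact Hz]).
assert (Hspeed : forall s, 0 <= s < T -> Cmod (g (ga s)) <= K * x s).
{ intros s Hs.
  set (N := fun t => (Re (g (ga t)) ^ 2 + Im (g (ga t)) ^ 2) / x t ^ 2).
  assert (HN : N s <= N 0).
  { apply nonincreasing_of_derive; [apply Hs |]. intros t Ht.
    assert (Ht' : 0 <= t < T) by lra.
    assert (Hxt := Hxge t Ht').
    destruct (proj2 HK _ (HPi t Ht')) as [_ [[f1 Hf1] _]].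
    set (g1 := (f1 * e)%C).
    assert (Hg1 : is_derive g (ga t) g1) by (apply is_derive_C_scal_r; exact Hf1).
    specialize (Hinf (ga t) g1 (HPi t Ht') Hg1). fold (g (ga t)) in Hinf.
    change (Re (ga t)) with (x t) in Hinf.
    destruct (curve_derive_comp g ga t _ _ Hg1 (Hga t Ht')) as [Ha Hb].
    set (a := Re (g (ga t))) in *. set (b := Im (g (ga t))) in *.
    exists (2 * (a ^ 2 + b ^ 2) * (Re g1 * x t - a) * / x t ^ 3). split.
    - assert (0 < / x t ^ 3) by (apply Rinv_0_lt_compat, pow_lt; lra).
      assert (0 <= a ^ 2 + b ^ 2).
      { assert (P1 := pow2_ge_0 a). assert (P2 := pow2_ge_0 b). lra. }
      assert (0 <= 2 * (a ^ 2 + b ^ 2) * / x t ^ 3) by nra. nra.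
    - replace (2 * (a ^ 2 + b ^ 2) * (Re g1 * x t - a) * / x t ^ 3) with
        (2 * ((a * Re (g1 * g (ga t))%C + b * Im (g1 * g (ga t))%C) * x t
              - (a ^ 2 + b ^ 2) * a) / x t ^ 3).
      + apply (is_derive_sqr_quotient (fun s => Re (g (ga s)))
                 (fun s => Im (g (ga s))) x); trivial; [| lra].
        apply Hx. exact Ht'.
      + change (Re (g1 * g (ga t))%C) with (Re g1 * a - Im g1 * b).
        change (Im (g1 * g (ga t))%C) with (Re g1 * b + Im g1 * a).
        field. lra. }
  assert (Hxs := Hxge s Hs).
  unfold N in HN. rewrite <- !Cmod2_alt, x0, ga0 in HN.
  assert (HNK : Cmod (g z) ^ 2 / Re z ^ 2 = K ^ 2) by (unfold K; field; lra).
  rewrite HNK in HN.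
  assert (Hsq : Cmod (g (ga s)) ^ 2 <= (K * x s) ^ 2).
  { apply Rmult_le_compat_r with (r := x s ^ 2) in HN; [| apply pow2_ge_0].
    replace (Cmod (g (ga s)) ^ 2 / x s ^ 2 * x s ^ 2)
      with (Cmod (g (ga s)) ^ 2) in HN by (field; lra).
    lra. }
  assert (0 <= Cmod (g (ga s))) by apply Cmod_ge_0.
  assert (0 <= K * x s) by (apply Rmult_le_pos; lra). nra. }
set (L := Re z * exp (K * T)).
assert (HxL : forall s, 0 <= s < T -> x s <= L).
{ intros s Hs.
  assert (H : x s * exp (- K * s) <= x 0 * exp (- K * 0)).
  { apply (nonincreasing_of_derive (fun t => x t * exp (- K * t))); [apply Hs |].
    intros t Ht. assert (Ht' : 0 <= t < T) by lra.
    exists ((Re (g (ga t)) - K * x t) * exp (- K * t)). split.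
    - assert (H1 := Hspeed t Ht'). assert (H2 := re_le_Cmod (g (ga t))).
      apply Rabs_le_between in H2. assert (H3 := exp_pos (- K * t)). nra.
    - replace ((Re (g (ga t)) - K * x t) * exp (- K * t)) with
        (Re (g (ga t)) * exp (- K * t) + x t * (- K * exp (- K * t))) by ring.
      apply (Derive.is_derive_mult x (fun r => exp (- K * r)));
        [apply Hx; exact Ht' |].
      auto_derive; [trivial | ring]. }
  rewrite x0, Rmult_0_r, exp_0, Rmult_1_r in H.
  apply Rmult_le_compat_r with (r := exp (K * s)) in H; [| left; apply exp_pos].
  rewrite Rmult_assoc, <- exp_plus in H.
  replace (- K * s + K * s) with 0 in H by ring. rewrite exp_0, Rmult_1_r in H.
  eapply Rle_trans; [exact H |]. unfold L.
  apply Rmult_le_compat_l; [lra |].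
  destruct (Req_dec (K * s) (K * T)) as [-> | Hne]; [lra |].
  left. apply exp_increasing. assert (K * s <= K * T) by (apply Rmult_le_compat_l; lra).
  lra. }
assert (Hy : forall sg, (sg = 1 \/ sg = -1) -> forall s, 0 <= s < T ->
  sg * Im (ga s) <= sg * Im z + K * L * T).
{ intros sg Hsg s Hs.
  assert (H : sg * Im (ga s) - K * L * s <= sg * Im (ga 0) - K * L * 0).
  { apply (nonincreasing_of_derive (fun t => sg * Im (ga t) - K * L * t)); [apply Hs |].
    intros t Ht. assert (Ht' : 0 <= t < T) by lra.
    exists (sg * Im (g (ga t)) - K * L). split.
    - assert (H1 := Hspeed t Ht'). assert (H2 := im_le_Cmod (g (ga t))).
      apply Rabs_le_between in H2. assert (H3 := HxL t Ht').
      assert (K * x t <= K * L) by (apply Rmult_le_compat_l; lra).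
      destruct Hsg as [-> | ->]; lra.
    - apply (is_derive_minus (V := R_NormedModule)).
      + apply is_derive_scal. apply Hga. exact Ht'.
      + auto_derive; [trivial | ring]. }
  rewrite ga0 in H.
  assert (0 <= L) by (apply Rmult_le_pos; [lra | left; apply exp_pos]).
  assert (0 <= K * L) by (apply Rmult_le_pos; lra). nra. }
exists (L + (Rabs (Im z) + K * L * T)). intros s Hs. split; [apply Hxge; exact Hs |].
eapply Rle_trans; [apply Cmod_le_Re_Im |]. apply Rplus_le_compat.
- fold ga. change (Re (ga s)) with (x s). rewrite Rabs_pos_eq; [apply HxL; exact Hs |].
  specialize (Hxge s Hs). lra.
- fold ga. assert (H1 := Hy 1 (or_introl eq_refl) s Hs).
  assert (H2 := Hy (-1) (or_intror eq_refl) s Hs).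
  assert (H3 := Rle_abs (Im z)). assert (H4 := Rle_abs (- Im z)).
  rewrite Rabs_Ropp in H4. apply Rabs_le. lra.
Qed.

(** * Global orbits, rays and sectors *)

Lemma closed_truncated_half_plane (a M : R) :
  closed (T := C_UniformSpace) (fun z => a <= Re z /\ Cmod z <= M).
Proof.
apply closed_and.
- apply (closed_comp (U := R_UniformSpace) Re (fun x => a <= x));
    [| apply closed_ge].
  intros z. apply (continuous_fst (U := R_UniformSpace) (V := R_UniformSpace)).
- apply (closed_comp (U := R_UniformSpace) Cmod (fun x => x <= M));
    [exact continuous_Cmod_id | apply closed_le].
Qed.

(** The distance from [h] to the endpoint attains its minimum over the compact set
    containing the orbit, and it takes arbitrarily small values there. *)
Lemma image_of_bounded_orbit (h f : C -> C) (e z : C) (T M : R) :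
  koenigs_of h f -> Pi z -> 0 < T ->
  (forall s, 0 <= s < T -> image Pi h (h z + RtoC s * e)%C /\
     Re z <= Re (orbit h e z s) /\ Cmod (orbit h e z s) <= M) ->
  image Pi h (h z + RtoC T * e)%C.
Proof.
intros HK Hz HT Hb. set (p := (h z + T * e)%C).
destruct (extreme_value (fun y => Re z <= Re y /\ Cmod y <= M)
            (fun y => - Cmod (h y - p)%C) M) as [m [Hm Hmax]].
- intros y Hy. apply Hy.
- apply closed_truncated_half_plane.
- intros y Hy.
  apply (continuous_opp (V := R_NormedModule) (fun u => Cmod (h u - p)%C)).
  apply continuous_dist. assert (HPy : Pi y) by (unfold Pi in *; lra).
  exists (/ f y)%C. apply HK. exact HPy.
- exists (orbit h e z 0). apply Hb. lra.
- exists m. split; [unfold Pi in *; lra |].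
  assert (Hle : Cmod (h m - p)%C <= 0).
  { apply le_epsilon. intros eps Heps. assert (He := Cmod_ge_0 e).
    set (d := Rmin T (eps / (Cmod e + 1))).
    assert (Hd : 0 < d) by (apply Rmin_pos; [lra | apply Rdiv_lt_0_compat; lra]).
    assert (d1 : d <= T) by apply Rmin_l.
    assert (d2 : d * (Cmod e + 1) <= eps).
    { apply Rle_trans with (eps / (Cmod e + 1) * (Cmod e + 1)).
      - apply Rmult_le_compat_r; [lra | apply Rmin_r].
      - right. field. lra. }
    assert (Hs : 0 <= T - d < T) by lra.
    destruct (Hb _ Hs) as [Him Hin]. specialize (Hmax _ Hin).
    rewrite (proj2 (orbit_spec h e z _ Him)) in Hmax.
    replace (h z + (T - d)%R * e - p)%C with (RtoC (- d) * e)%C in Hmax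
      by (unfold p; rewrite RtoC_minus, RtoC_opp; ring).
    rewrite Cmod_mult, Cmod_R, Rabs_Ropp, Rabs_pos_eq in Hmax by lra. lra. }
  assert (H0 : (h m - p)%C = 0%C).
  { apply Cmod_eq_0. apply Rle_antisym; [exact Hle | apply Cmod_ge_0]. }
  replace (h m) with (h m - p + p)%C by ring. rewrite H0. ring.
Qed.

(** The first time at which [h z + t e] is outside the image does not exist:
    the bound on orbits puts the endpoint of an interval in the image, and
    the image is open. *)
Lemma image_ray (h f : C -> C) (e z : C) :
  koenigs_of h f ->
  (forall y, Pi y -> 0 <= Re (f y * e)%C) ->
  (forall y g1, Pi y -> is_derive (fun w => f w * e)%C y g1 ->
     Re g1 * Re y <= Re (f y * e)%C) ->
  Pi z -> forall t, 0 <= t -> image Pi h (h z + RtoC t * e)%C.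
Proof.
intros HK Hpos Hinf Hz t Ht. apply NNPP. intros Hno.
set (E := fun s => 0 <= s /\ forall r, 0 <= r <= s -> image Pi h (h z + RtoC r * e)%C).
assert (H0 : image Pi h (h z + RtoC 0 * e)%C).
{ exists z. split; [exact Hz | ring]. }
assert (HE0 : E 0).
{ split; [lra |]. intros r Hr. replace r with 0 by lra. exact H0. }
destruct (completeness E) as [T [HT1 HT2]].
- exists t. intros s [Hs1 Hs2]. apply Rnot_lt_le. intros Hlt. apply Hno, Hs2. lra.
- exists 0. exact HE0.
- assert (HT0 : 0 <= T) by (apply HT1; exact HE0).
  assert (Hbelow : forall s, 0 <= s < T -> image Pi h (h z + RtoC s * e)%C).
  { intros s Hs. apply NNPP. intros Hs'.
    assert (T <= s); [| lra]. apply HT2. intros s' [H1 H2].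
    apply Rnot_lt_le. intros Hlt. apply Hs', H2. lra. }
  assert (HimT : image Pi h (h z + RtoC T * e)%C).
  { destruct HT0 as [HT0 | <-]; [| exact H0].
    destruct (orbit_bounded h f e z T HK Hpos Hinf Hz HT0 Hbelow) as [M HM].
    apply (image_of_bounded_orbit h f e z T M HK Hz HT0).
    intros s Hs. split; [apply Hbelow, Hs | apply HM, Hs]. }
  assert (Hop := locally_line _ e _ (koenigs_image_open h f _ HK HimT)).
  destruct Hop as [d Hd]. assert (Hd0 := cond_pos d).
  assert (HE : E (T + d / 2)).
  { split; [lra |]. intros r Hr.
    destruct (Rlt_dec r T) as [HrT | HrT]; [apply Hbelow; lra |].
    replace (h z + r * e)%C with (h z + T * e + RtoC (r - T) * e)%C
      by (rewrite RtoC_minus; ring).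
    apply Hd. change (Rabs (r - T - 0) < d). rewrite Rminus_0_r, Rabs_pos_eq; lra. }
  apply HT1 in HE. lra.
Qed.

Lemma orbit_Re_ge (h f : C -> C) (e z : C) :
  koenigs_of h f ->
  (forall y, Pi y -> 0 <= Re (f y * e)%C) ->
  (forall t, 0 <= t -> image Pi h (h z + RtoC t * e)%C) ->
  Pi z -> forall t, 0 <= t -> Re z <= Re (orbit h e z t).
Proof.
intros HK Hpos Him Hz t Ht.
assert (H : - Re (orbit h e z t) <= - Re (orbit h e z 0)).
{ apply (nonincreasing_of_derive (fun s => - Re (orbit h e z s))); [exact Ht |].
  intros s Hs. exists (- Re (f (orbit h e z s) * e)%C). split.
  - assert (H := Hpos _ (proj1 (orbit_spec h e z s (Him s (proj1 Hs))))). lra.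
  - apply (is_derive_opp (V := R_NormedModule)).
    apply (orbit_derive h f e z s HK (Him s (proj1 Hs))). }
rewrite orbit_0 in H by (trivial; apply HK). lra.
Qed.

(** Orbits do not approach the imaginary axis, and [h] is bounded on the part of
    [Re y >= Re z] in a disc, whereas [h] is unbounded along the orbit. *)
Lemma orbit_tends_to_infinity (h f : C -> C) (e z : C) :
  koenigs_of h f -> e <> 0%C ->
  (forall y, Pi y -> 0 <= Re (f y * e)%C) ->
  (forall t, 0 <= t -> image Pi h (h z + RtoC t * e)%C) ->
  Pi z -> tends_to_infinity (orbit h e z).
Proof.
intros HK He Hpos Him Hz. apply tends_to_infinity_iff. intros M.
assert (HeM := proj1 (Cmod_gt_0 e) He).
assert (HB : exists B, forall y, Re z <= Re y -> Cmod y <= M -> Cmod (h y - 0)%C <= B).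
{ destruct (classic (exists y, Re z <= Re y /\ Cmod y <= M)) as [Hex | Hex].
  - destruct (extreme_value (fun y => Re z <= Re y /\ Cmod y <= M)
              (fun y => Cmod (h y - 0)%C) M) as [m [_ Hm]]; trivial.
    + intros y Hy. apply Hy.
    + apply closed_truncated_half_plane.
    + intros y Hy. apply continuous_dist.
      assert (HPy : Pi y) by (unfold Pi in *; lra).
      exists (/ f y)%C. apply HK. exact HPy.
    + exists (Cmod (h m - 0)%C). intros y H1 H2. apply Hm. split; assumption.
  - exists 0. intros y H1 H2. exfalso. apply Hex. exists y. auto. }
destruct HB as [B HB].
exists (Rmax 0 ((B + Cmod (h z)) / Cmod e)). intros t Ht.
assert (Ht0 := Rle_lt_trans _ _ _ (Rmax_l _ _) Ht).
assert (Ht1 := Rle_lt_trans _ _ _ (Rmax_r _ _) Ht).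
apply Rnot_le_lt. intros HM.
specialize (HB _ (orbit_Re_ge h f e z HK Hpos Him Hz t (Rlt_le _ _ Ht0)) HM).
rewrite (proj2 (orbit_spec h e z t (Him t (Rlt_le _ _ Ht0)))) in HB.
assert (T := Cmod_triangle_rev (t * e)%C (- h z)%C).
replace (t * e - - h z)%C with (h z + t * e - 0)%C in T by ring.
rewrite Cmod_opp, Cmod_mult, Cmod_R, Rabs_pos_eq in T by lra.
apply Rmult_lt_compat_r with (r := Cmod e) in Ht1; [| exact HeM].
replace ((B + Cmod (h z)) / Cmod e * Cmod e) with (B + Cmod (h z)) in Ht1
  by (field; lra).
lra.
Qed.

Lemma cis_neq_0 (theta : R) : cis theta <> 0%C.
Proof.
intros H. assert (H1 : cos theta = 0) by (injection H; auto).
assert (H2 : sin theta = 0) by (injection H; auto).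
assert (H3 := sin2_cos2 theta). unfold Rsqr in H3. rewrite H1, H2 in H3. lra.
Qed.

Lemma cis_plus (a b : R) : (cis a * cis b)%C = cis (a + b).
Proof.
unfold cis, Cmult; simpl. rewrite cos_plus, sin_plus. f_equal; ring.
Qed.

(** The real part is [|z| cos (arg z + theta)]. If [arg z] violates a bound, a
    suitable [theta], halfway to the end of the interval, makes the cosine
    negative. *)
Lemma sector_iff (theta1 theta2 : R) (z : C) :
  0 < theta1 -> 0 < theta2 -> theta1 + theta2 <= PI -> z <> 0%C ->
  (- (PI / 2) + theta1 <= arg z <= PI / 2 - theta2 <->
   forall theta, - theta1 < theta < theta2 -> 0 <= Re (z * cis theta)%C).
Proof.
intros H1 H2 H12 Hz. destruct (arg_spec z Hz) as [Ha Ez].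
assert (Hm := proj1 (Cmod_gt_0 z) Hz).
assert (HRe : forall theta, Re (z * cis theta)%C = Cmod z * cos (arg z + theta)).
{ intros theta. rewrite Ez at 1. rewrite <- Cmult_assoc, cis_plus.
  unfold cis, Re; simpl. ring. }
set (al := arg z) in *. assert (Hpi := PI_RGT_0). split.
- intros Hs theta Ht. rewrite HRe. apply Rmult_le_pos; [lra |].
  apply cos_ge_0; lra.
- intros H.
  assert (Hcos : forall theta, - theta1 < theta < theta2 -> 0 <= cos (al + theta)).
  { intros theta Ht. specialize (H theta Ht). rewrite HRe in H.
    apply Rnot_lt_le. intros Hlt. nra. }
  assert (H0 := Hcos 0). rewrite Rplus_0_r in H0.
  assert (Hc : 0 <= cos al) by (apply H0; lra).
  assert (Hal : - (PI / 2) <= al <= PI / 2).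
  { split; apply Rnot_lt_le; intros Hlt.
    - rewrite <- cos_neg in Hc.
      assert (cos (- al) < 0) by (apply cos_lt_0; lra). lra.
    - assert (cos al < 0) by (apply cos_lt_0; lra). lra. }
  split; apply Rnot_lt_le; intros Hlt.
  + assert (Hn := Hcos ((- (PI / 2) - al - theta1) / 2)).
    rewrite <- cos_neg in Hn.
    assert (Hneg : cos (- (al + (- (PI / 2) - al - theta1) / 2)) < 0)
      by (apply cos_lt_0; lra).
    assert (0 <= cos (- (al + (- (PI / 2) - al - theta1) / 2))) by (apply Hn; lra).
    lra.
  + assert (Hn := Hcos ((PI / 2 - al + theta2) / 2)).
    assert (Hneg : cos (al + (PI / 2 - al + theta2) / 2) < 0)
      by (apply cos_lt_0; lra).
    assert (0 <= cos (al + (PI / 2 - al + theta2) / 2)) by (apply Hn; lra).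
    lra.
Qed.

Lemma arg_polar (r theta : R) :
  0 < r -> - PI < theta < PI -> arg (r * cis theta)%C = theta.
Proof.
intros Hr Ht.
assert (Hm : Cmod (r * cis theta)%C = r).
{ rewrite Cmod_mult, Cmod_R, Rabs_pos_eq by lra.
  replace (Cmod (cis theta)) with 1; [ring |].
  assert (H := Cmod2_alt (cis theta)). assert (H3 := sin2_cos2 theta).
  unfold cis, Re, Im, Rsqr in *; simpl in *.
  assert (H4 := Cmod_ge_0 (cos theta, sin theta)). nra. }
unfold arg. rewrite Hm.
replace (Re (r * cis theta)%C) with (r * cos theta)
  by (unfold cis, Re; simpl; ring).
replace (Im (r * cis theta)%C) with (r * sin theta)
  by (unfold cis, Im; simpl; ring).
replace (r * cos theta / r) with (cos theta) by (field; lra).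
destruct (Rle_dec 0 (r * sin theta)) as [Hs | Hs].
- apply acos_cos. split; [| lra]. apply Rnot_lt_le. intros Hlt.
  assert (0 < sin (- theta)) by (apply sin_gt_0; lra).
  rewrite sin_neg in H. nra.
- rewrite <- (cos_neg theta), acos_cos; [ring |].
  split; [| lra]. apply Rnot_lt_le. intros Hlt. apply Hs.
  apply Rmult_le_pos; [lra | apply sin_ge_0; lra].
Qed.

Lemma Omega_polar (theta1 theta2 r theta : R) :
  theta1 <= PI -> theta2 <= PI -> 0 < r -> - theta1 < theta < theta2 ->
  Omega theta1 theta2 (r * cis theta)%C.
Proof.
intros H1 H2 Hr Ht. split.
- apply Cmult_neq_0; [| apply cis_neq_0]. intros H. apply RtoC_inj in H. lra.
- rewrite arg_polar by lra. exact Ht.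
Qed.

Lemma curve_derive_arc (r theta : R) :
  curve_derive (fun t => r * cis t)%C theta (r * cis theta * Ci)%C.
Proof.
split; unfold cis, Re, Im; simpl; auto_derive; trivial; ring.
Qed.

(** * Analytic extensions *)

Lemma curve_constant (c : R -> C) (a b : R) :
  a < b -> (forall t, a <= t <= b -> curve_derive c t 0%C) -> c a = c b.
Proof.
intros Hab H. apply injective_projections.
- apply (eq_is_derive (V := R_NormedModule) (fun t => Re (c t))); [| exact Hab].
  intros t Ht. apply H. exact Ht.
- apply (eq_is_derive (V := R_NormedModule) (fun t => Im (c t))); [| exact Hab].
  intros t Ht. apply H. exact Ht.
Qed.

(** The derivative in [zeta] exists, so it may be computed with increments
    [t > 0], for which [G (t + zeta) z = F t (G zeta z)]. *)
Lemma extension_derive (F : R -> C -> C) (f : C -> C) (G : C -> C -> C)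
    (theta1 theta2 : R) (zeta z : C) :
  is_generator F f -> analytic_extension F theta1 theta2 G ->
  0 < theta1 <= PI -> 0 < theta2 <= PI ->
  Omega theta1 theta2 zeta -> Pi z ->
  is_derive (fun w => G w z) zeta (f (G zeta z)).
Proof.
intros [_ Hgen] [HG [HGF [HGh HGs]]] H1 H2 Hzeta Hz.
assert (Hex : exists l : C, is_derive (fun w => G w z) zeta l)
  by exact (HGh z Hz zeta Hzeta).
destruct Hex as [l Hl].
assert (Hw : Pi (G zeta z)) by (apply HG; assumption).
set (w := G zeta z) in *.
assert (E : Cmod (l - f w)%C <= 0).
{ apply le_epsilon. intros eps Heps.
  destruct (proj1 (is_derive_C_eps _ _ _) Hl (eps / 2)) as [d [Hd Hd1]]; [lra |].
  assert (Hq : at_right 0 (fun t : R => Cmod ((F t w - w) / t - f w)%C < eps / 2)).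
  { apply (Hgen w Hw (fun y => Cmod (y - f w)%C < eps / 2)).
    apply locally_C_Cmod. exists (eps / 2). split; [lra | auto]. }
  destruct (at_right_pos _ Hq d Hd) as [t [Ht Hqt]].
  specialize (Hd1 (RtoC t + zeta)%C).
  replace (t + zeta - zeta)%C with (RtoC t) in Hd1 by ring.
  rewrite Cmod_R, Rabs_pos_eq in Hd1 by lra. specialize (Hd1 (proj2 Ht)).
  assert (Ht0 : RtoC t <> 0%C) by (intros H; apply RtoC_inj in H; lra).
  assert (HOt : Omega theta1 theta2 t).
  { assert (H := Omega_polar theta1 theta2 t 0).
    replace (t * cis 0)%C with (RtoC t) in H.
    - apply H; lra.
    - unfold cis. rewrite cos_0, sin_0.
      change (RtoC t = t * RtoC 1)%C. ring. }
  rewrite <- (HGs t zeta z HOt Hzeta Hz) in Hd1. fold w in Hd1.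
  rewrite (HGF t w (proj1 Ht) Hw) in Hd1.
  set (q := ((F t w - w) / t)%C) in *.
  assert (Eq : (F t w - w)%C = (t * q)%C) by (unfold q; field; exact Ht0).
  rewrite Eq in Hd1.
  replace (t * q - l * t)%C with (t * (q - l))%C in Hd1 by ring.
  rewrite Cmod_mult, Cmod_R, Rabs_pos_eq in Hd1 by lra.
  assert (H3 : Cmod (q - l)%C <= eps / 2) by (apply Rmult_le_reg_l with t; lra).
  assert (T := Cmod_triangle (l - q)%C (q - f w)%C).
  replace (l - q + (q - f w))%C with (l - f w)%C in T by ring.
  rewrite (Cmod_minus_sym l q) in T. lra. }
replace (f w) with l; [exact Hl |].
assert (H0 : (l - f w)%C = 0%C).
{ apply Cmod_eq_0. apply Rle_antisym; [exact E | apply Cmod_ge_0]. }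
replace l with (l - f w + f w)%C by ring. rewrite H0. ring.
Qed.

(** By the chain rule [h (G zeta z) - zeta] has zero derivative in [zeta]. The arc of
    radius [r] joins the given point to the positive real axis, where
    [G] is the semigroup. *)
Lemma extension_koenigs (F : R -> C -> C) (f h : C -> C) (G : C -> C -> C)
    (theta1 theta2 r theta : R) (z : C) :
  is_generator F f -> is_koenigs F h -> koenigs_of h f ->
  analytic_extension F theta1 theta2 G ->
  0 < theta1 <= PI -> 0 < theta2 <= PI ->
  0 < r -> - theta1 < theta < theta2 -> Pi z ->
  h (G (r * cis theta)%C z) = (h z + r * cis theta)%C.
Proof.
intros Hgen [_ [Hkoe _]] HK HG H1 H2 Hr Ht Hz.
set (c := fun t => (h (G (r * cis t)%C z) + - (r * cis t))%C).
assert (Hd : forall t, - theta1 < t < theta2 -> curve_derive c t 0%C).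
{ intros t Ht'.
  assert (HO : Omega theta1 theta2 (r * cis t)%C) by (apply Omega_polar; lra).
  assert (HGP : Pi (G (r * cis t)%C z)) by (apply HG; assumption).
  destruct (proj2 HK _ HGP) as [Hf0 [_ Hh]].
  replace (RtoC 0) with
    ((/ f (G (r * cis t) z) * f (G (r * cis t) z) + - (1)) * (r * cis t * Ci))%C
    by (field; exact Hf0).
  apply (curve_derive_comp (fun w => h (G w z) + - w)%C (fun s => r * cis s)%C);
    [| apply curve_derive_arc].
  apply (is_derive_plus (V := C_NormedModule)).
  - apply (is_derive_C_comp h (fun w => G w z)); [exact Hh |].
    apply (extension_derive F f G theta1 theta2); assumption.
  - exact (is_derive_opp _ _ _ (is_derive_C_id (r * cis t)%C)). }
assert (Hc : c theta = c 0).
{ destruct (Rtotal_order theta 0) as [Hlt | [-> | Hgt]]; [| reflexivity |].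
  - apply curve_constant; [exact Hlt |]. intros t Ht'. apply Hd. lra.
  - symmetry. apply curve_constant; [exact Hgt |]. intros t Ht'. apply Hd. lra. }
assert (E0 : (r * cis 0)%C = RtoC r).
{ unfold cis. rewrite cos_0, sin_0. change (r * RtoC 1 = RtoC r)%C. ring. }
assert (Hc0 : c 0 = h z).
{ unfold c. rewrite E0, (proj1 (proj2 HG) r z Hr Hz), Hkoe by (trivial; lra). ring. }
replace (h (G (r * cis theta) z))%C with (c theta + r * cis theta)%C
  by (unfold c; ring).
rewrite Hc, Hc0. reflexivity.
Qed.

Lemma Sigma_of_extension (F : R -> C -> C) (f h : C -> C) (G : C -> C -> C)
    (theta1 theta2 : R) :
  is_generator F f -> is_koenigs F h -> koenigs_of h f ->
  analytic_extension F theta1 theta2 G ->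
  (forall z, Pi z -> forall theta, - theta1 < theta < theta2 ->
     tends_to_infinity (fun t : R => G (t * cis theta)%C z)) ->
  0 < theta1 <= PI -> 0 < theta2 <= PI ->
  Sigma theta1 theta2 h.
Proof.
intros Hgen Hkoe HK HG Hinf H1 H2 theta Ht.
split; [apply Hkoe |]. split; [apply Hkoe |]. intros z Hz.
assert (HGP : forall t, 0 < t -> Pi (G (t * cis theta)%C z)).
{ intros t Ht0. apply HG; [apply Omega_polar; lra | exact Hz]. }
assert (Hh := fun t Ht0 => extension_koenigs F f h G theta1 theta2 t theta z
                Hgen Hkoe HK HG H1 H2 Ht0 Ht Hz).
split.
- intros t Ht0. exists (G (t * cis theta)%C z). auto.
- apply tends_to_infinity_iff. intros M.
  destruct (proj1 (tends_to_infinity_iff _) (Hinf z Hz theta Ht) M) as [N HN].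
  exists (Rmax 0 N). intros t HtN.
  assert (Ht0 := Rle_lt_trans _ _ _ (Rmax_l _ _) HtN).
  rewrite <- (Hh t Ht0), inv_on_left; [| apply HK | exact (HGP t Ht0)].
  apply HN. exact (Rle_lt_trans _ _ _ (Rmax_r _ _) HtN).
Qed.

Lemma extension_of_Sigma (F : R -> C -> C) (f h : C -> C) (theta1 theta2 : R) :
  continuous_semigroup F -> is_koenigs F h -> koenigs_of h f ->
  Sigma theta1 theta2 h ->
  exists G : C -> C -> C,
    analytic_extension F theta1 theta2 G /\
    forall z, Pi z -> forall theta, - theta1 < theta < theta2 ->
      tends_to_infinity (fun t : R => G (t * cis theta)%C z).
Proof.
intros [HF _] [_ [Hkoe _]] HK HS.
assert (Him : forall zeta z, Omega theta1 theta2 zeta -> Pi z ->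
  image Pi h (h z + zeta)%C).
{ intros zeta z [H0 Ha] Hz. destruct (arg_spec zeta H0) as [_ ->].
  apply (HS (arg zeta) Ha); [exact Hz | apply Cmod_gt_0; exact H0]. }
exists (fun zeta z => inv_on Pi h (h z + zeta)%C).
split; [| intros z Hz theta Ht; exact (proj2 (proj2 (proj2 (HS theta Ht)) z Hz))].
split; [| split; [| split]].
- intros zeta Hzeta. split.
  + intros z Hz. eexists.
    apply (is_derive_C_comp (inv_on Pi h) (fun w => h w + zeta)%C).
    * apply (koenigs_inv_derive h f); [exact HK |]. apply Him; assumption.
    * apply (is_derive_plus (V := C_NormedModule)); [apply HK, Hz | apply is_derive_C_const].
  + intros z Hz. apply inv_on_image. apply Him; assumption.
- intros t z Ht Hz. rewrite <- Hkoe by (trivial; lra).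
  apply inv_on_left; [apply HK | apply HF; [lra | exact Hz]].
- intros z Hz zeta Hzeta. eexists.
  apply (is_derive_C_comp (inv_on Pi h) (fun w => h z + w)%C).
  + apply (koenigs_inv_derive h f); [exact HK |]. apply Him; assumption.
  + apply (is_derive_plus (V := C_NormedModule));
      [apply is_derive_C_const | apply is_derive_C_id].
- intros zeta1 zeta2 z H1 H2 Hz.
  rewrite (proj2 (inv_on_image _ _ _ (Him zeta2 z H2 Hz))).
  f_equal. ring.
Qed.

Theorem theorem3p1 :
  forall (f : C -> C) (F : R -> C -> C) (h : C -> C),
    continuous_semigroup F ->
    is_generator F f ->
    denjoy_wolff_at_infinity F ->
    is_koenigs F h ->
    forall theta1 theta2 : R,
      0 < theta1 -> 0 < theta2 -> theta1 + theta2 <= PI ->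
      ((exists G : C -> C -> C,
          analytic_extension F theta1 theta2 G /\
          forall z, Pi z ->
          forall theta, - theta1 < theta < theta2 ->
            tends_to_infinity (fun t : R => G (t * cis theta)%C z))
       <->
       (forall z, Pi z ->
          f z <> 0%C /\
          - (PI / 2) + theta1 <= arg (f z) <= PI / 2 - theta2))
      /\
      ((forall z, Pi z ->
          f z <> 0%C /\
          - (PI / 2) + theta1 <= arg (f z) <= PI / 2 - theta2)
       <->
       Sigma theta1 theta2 h).
Proof.
intros f F h HF Hgen _ Hkoe theta1 theta2 H1 H2 H12.
assert (HK := koenigs_of_generator F f h HF Hgen Hkoe).
assert (Hsec : (forall z, Pi z -> f z <> 0%C /\
          - (PI / 2) + theta1 <= arg (f z) <= PI / 2 - theta2) <->
  (forall theta, - theta1 < theta < theta2 ->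
     forall z, Pi z -> 0 <= Re (f z * cis theta)%C)).
{ split.
  - intros H theta Ht z Hz. destruct (H z Hz) as [H0 Ha].
    revert theta Ht. apply sector_iff; assumption.
  - intros H z Hz. assert (H0 := proj1 (proj2 HK z Hz)). split; [exact H0 |].
    apply sector_iff; trivial. intros theta Ht. apply H; assumption. }
assert (Hii_iii : (forall z, Pi z -> f z <> 0%C /\
          - (PI / 2) + theta1 <= arg (f z) <= PI / 2 - theta2) <->
        Sigma theta1 theta2 h).
{ rewrite Hsec. split.
  - intros H theta Ht. split; [apply Hkoe |]. split; [apply Hkoe |].
    intros z Hz. specialize (H theta Ht).
    assert (Him1 : forall y t, Pi y -> 0 <= t -> image Pi h (h y + RtoC t * 1)%C).
    { intros y t Hy Ht0. exists (F t y). split; [apply HF; assumption |].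
      rewrite (proj1 (proj2 Hkoe)) by assumption. ring. }
    assert (Hray := fun y Hy => image_ray h f (cis theta) y HK H
      (fun w g1 Hw Hg => schwarz_pick_infinitesimal _ w g1 H
         (schwarz_pick_generator h f (cis theta) HK Him1 H) Hw Hg) Hy).
    split.
    + intros t Ht0. apply Hray; [exact Hz | lra].
    + apply (orbit_tends_to_infinity h f); trivial; [apply cis_neq_0 |].
      apply Hray. exact Hz.
  - intros HS theta Ht.
    apply (generator_nonneg h f (cis theta) HK).
    intros z Hz. exact (proj2 (proj2 (HS theta Ht)) z Hz). }
split; [| exact Hii_iii]. rewrite Hii_iii. split.
- intros [G [HG Hinf]].
  apply (Sigma_of_extension F f h G); trivial; lra.
- apply (extension_of_Sigma F f h); assumption.
Qed.
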